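(* Let $P\subset\mathbb R^d$ be a lattice-face $d$-polytope. Then for every positive integer $m$, $$i(P,m)=\mathrm{Vol}(mP)+i(\pi(P),m)=\sum_{k=0}^{d}\mathrm{Vol}_k\big(\pi^{(d-k)}(P)\big)\,m^k .$$
   Context: For $k\ge1$, $\pi:\mathbb R^k\to\mathbb R^{k-1}$ is the map forgetting the last coordinate, and $\pi^{(j)}:\mathbb R^k\to\mathbb R^{k-j}$ forgets the last $j$ coordinates ($\mathbb R^0$ is a point). For a polytope $Q$ and a positive integer $m$, $i(Q,m)=|mQ\cap\mathbb Z^{\dim}|$ is the number of lattice points in $mQ=\{mx:x\in Q\}$. $\mathrm{Vol}_k$ denotes $k$-dimensional Euclidean volume in $\mathbb R^k$ (with $\mathrm{Vol}_0$ of a point equal to $1$), $\mathrm{Vol}=\mathrm{Vol}_d$, and $i(\pi(P),m)$ for $d=1$ is $1$. Lattice-face polytopes are defined recursively: a $1$-dimensional polytope (segment) in $\mathbb R$ is lattice-face if its endpoints are integers. For $d\ge2$, a $d$-dimensional polytope $P\subset\mathbb R^d$ with vertex set $V$ is lattice-face if for every $d$-element subset $U\subset V$: (a) $\pi(\mathrm{conv}(U))$ is a lattice-face polytope in $\mathbb R^{d-1}$, and (b) $\pi(H_U\cap\mathbb Z^d)=\mathbb Z^{d-1}$, where $H_U$ is the affine span of $U$. *)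

(* Defs.v *)
From HB Require Import structures.
From mathcomp Require Import all_boot all_order all_algebra.
From mathcomp Require Import all_classical all_reals.
From mathcomp Require Import finmap ereal sequences.

Set Implicit Arguments.
Unset Strict Implicit.
Unset Printing Implicit Defensive.

Import Order.TTheory GRing.Theory Num.Theory.
Local Open Scope classical_set_scope.
Local Open Scope ring_scope.

Section LatticeFace.
Variable R : realType.
Local Notation pt k := 'rV[R]_k.

Definition proj_forget (k j : nat) (x : pt k) : pt (k - j) :=
  \row_(i < k - j) x ord0 (widen_ord (leq_subr j k) i).

Definition proj_last (k : nat) (x : pt k) : pt k.-1 :=
  \row_(i < k.-1) x ord0 (widen_ord (leq_pred k) i).

Definition lattice (k : nat) : set (pt k) :=
  [set x | forall i : 'I_k, x ord0 i \is a Num.int].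

Definition conv_hull (k : nat) (S : set (pt k)) : set (pt k) :=
  [set x | exists (n : nat) (p : 'I_n -> pt k) (w : 'I_n -> R),
     [/\ forall i, S (p i), forall i, 0 <= w i, \sum_(i < n) w i = 1
       & x = \sum_(i < n) w i *: p i]].

Definition aff_hull (k : nat) (S : set (pt k)) : set (pt k) :=
  [set x | exists (n : nat) (p : 'I_n -> pt k) (w : 'I_n -> R),
     [/\ forall i, S (p i), \sum_(i < n) w i = 1
       & x = \sum_(i < n) w i *: p i]].

Definition polytope (k : nat) (P : set (pt k)) : Prop :=
  exists s : seq (pt k), P = conv_hull [set` s].

Definition full_polytope (k : nat) (P : set (pt k)) : Prop :=
  polytope P /\ aff_hull P = setT.

Definition is_vertex (k : nat) (P : set (pt k)) (v : pt k) : Prop :=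
  P v /\ ~ conv_hull (P `\ v) v.

(* a 1-dimensional polytope (segment [a,b], a < b) in R is lattice-face
   iff its endpoints are integers; stated for points of R^(n+1) but only used with
   n = 0, i.e. in R^1 (ord0 is then the only coordinate) *)
Definition lattice_face_1 (n : nat) (P : set (pt n.+1)) : Prop :=
  exists a b : int, a < b /\ P = [set x | a%:~R <= x ord0 ord0 <= b%:~R].

Definition lattice_face_step (d : nat) (rec : set (pt d.-1) -> Prop)
    (P : set (pt d)) : Prop :=
  full_polytope P /\
  forall u : 'I_d -> pt d, injective u -> (forall i, is_vertex P (u i)) ->
    rec (proj_last (k:=d) @` conv_hull (range u)) /\
    proj_last (k:=d) @` (aff_hull (range u) `&` lattice (k:=d)) = lattice (k:=d.-1).

Fixpoint lattice_face (d : nat) : set (pt d) -> Prop :=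
  match d return set (pt d) -> Prop with
  | 0 => fun _ => False
  | n.+1 =>
    fun P => if n is 0 then lattice_face_1 P
             else @lattice_face_step n.+1 (@lattice_face n) P
  end.

Definition lattice_count (k : nat) (Q : set (pt k)) (m : nat) : nat :=
  #|` fset_set ((fun x => m%:R *: x) @` Q `&` lattice (k:=k)) |.

(* k-dimensional (Lebesgue outer) volume: infimum of the total volume of
   countable covers by closed boxes; each box may be used or not
   (so that Vol_0 of a point is 1 and Vol_0 of the empty set is 0). *)
Definition box (k : nat) (a b : pt k) : set (pt k) :=
  [set x | forall i : 'I_k, a ord0 i <= x ord0 i <= b ord0 i].

Definition box_vol (k : nat) (a b : pt k) : R :=
  \prod_(i < k) (b ord0 i - a ord0 i).

Definition Vol (k : nat) (S : set (pt k)) : \bar R :=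
  ereal_inf [set e | exists (a b : nat -> pt k) (u : nat -> bool),
    [/\ forall n (i : 'I_k), a n ord0 i <= b n ord0 i,
        S `<=` \bigcup_(n in [set n | u n]) box (a n) (b n)
      & e = (\sum_(0 <= n <oo) (if u n then (box_vol (a n) (b n))%:E else 0))%E]].

End LatticeFace.

(* Main.v *)
Require Import Defs.
From HB Require Import structures.
From mathcomp Require Import all_boot all_order all_algebra.
From mathcomp Require Import all_classical all_reals.
From mathcomp Require Import finmap ereal sequences.
From mathcomp Require Import topology normedtype.
From mathcomp Require Import ring lra zify.

(* Write [N P] for the number of points of [P] in the shifted lattice
   [Z^d - e_d / 2].  By condition (b) every fiber of [P] over a lattice point of
   the projection is a segment with integer endpoints, so the lattice points of
   [P] outnumber those of the projection by [N P].  It remains to see that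
   [N (m P) = m ^ d * N P]: the lattice count of [m P] is then a polynomial in
   [m] whose coefficients are the numbers [N] of the projections of [P], and
   comparing growth rates identifies each of them with a volume.

   No shifted lattice point lies on the span of [d] vertices, so a triangulation
   by cells with vertices among those of [P] reduces the homogeneity of [N] to a
   simplex.  Slice a simplex by [x_1 = t].  The slice is a signed sum, over the
   vertices [a] with [a_1 < t], of the slices of the cone at [a] whose edges are
   all flipped to point upwards.  Each of these is again a lattice-face simplex,
   of dimension [d - 1], and is a dilate by [t - a_1] of a fixed one, so by
   induction it contributes [e_a * (t - a_1) ^ (d - 1)].  These sums vanish for
   large [t], hence the moments [sum_a e_a * a_1 ^ j] vanish for [j < d]; summing
   over [t] only the moment of order [d] survives, and it is homogeneous. *)

Set Implicit Arguments.
Unset Strict Implicit.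
Unset Printing Implicit Defensive.

Import Order.TTheory GRing.Theory Num.Theory.


(** A slice of a simplex between two of its vertices is in general not a simplex, so induction on
    the dimension does not apply to it directly. Flipped cones repair this: the line of an edge
    meets an integral level in a point that still satisfies the integral relations of
    [lattice_general]. The signed decomposition can fail on the walls of the cones, and the half
    shift keeps every counted point off them.

    Points are functions [nat -> R] and the dimension is a bare number, so a projection keeps the
    family [v] and merely reads fewer coordinates. Hulls are given by weights on a finite index
    type; faces, cells and cones are subsets of it.

    Volumes enter only through box covers: from above, cubes indexed by lattice points of a slightly
    larger dilate; from below, finite subcovers that bound the lattice count of every dilate. Both
    comparisons err by a lower power of the dilation factor. *)

Local Open Scope ring_scope.

(** * Sums of powers and moments *)

Section Moments.
Variables (R : realType) (I : finType).
Implicit Types (S : {set I}) (e a : I -> R).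

Lemma expand_moments S e a n X :
  \sum_(i in S) e i * (X - a i) ^+ n =
  \sum_(j < n.+1) (\sum_(i in S) e i * a i ^+ j) * (-1) ^+ j * X ^+ (n - j) *+ 'C(n, j).
Proof.
under eq_bigr => i _ do rewrite exprBn mulr_sumr.
rewrite exchange_big /=; apply: eq_bigr => j _.
rewrite !mulr_suml -sumrMnl; apply: eq_bigr => i _.
rewrite mulrnAr; congr (_ *+ _); ring.
Qed.

Lemma poly_eq0_nat (p : {poly R}) (T : nat) :
  (forall t : nat, (T <= t)%N -> p.[t%:R] = 0) -> p = 0.
Proof.
move=> pE; apply/eqP/negPn/negP => pN0.
pose rs := [seq (T + i)%:R : R | i <- iota 0 (size p)].
have rsp : all (root p) rs.
  by apply/allP => _ /mapP[i _ ->]; rewrite rootE pE// leq_addr.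
have rsu : uniq rs.
  rewrite map_inj_uniq ?iota_uniq// => i1 i2 /eqP.
  by rewrite eqr_nat eqn_add2l => /eqP.
by have := max_poly_roots pN0 rsp rsu; rewrite size_map size_iota ltnn.
Qed.

(** The sum is a polynomial in [t] with infinitely many roots; its coefficient of [t ^ (n - j)] is
    the moment of order [j] times a nonzero signed binomial. *)
Lemma moments_eq0 S e a n (T : nat) :
  (forall t : nat, (T <= t)%N -> \sum_(i in S) e i * (t%:R - a i) ^+ n = 0) ->
  forall j, (j <= n)%N -> \sum_(i in S) e i * a i ^+ j = 0.
Proof.
move=> h j lejn.
pose m j := \sum_(i in S) e i * a i ^+ j.
pose p := \poly_(l < n.+1) (m (n - l)%N * (-1) ^+ (n - l) *+ 'C(n, (n - l))).
have pE (t : nat) : (T <= t)%N -> p.[t%:R] = 0.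
  move=> leTt; rewrite -(h _ leTt) expand_moments horner_poly.
  rewrite (reindex_inj rev_ord_inj) /=; apply: eq_bigr => l _.
  by rewrite subSS subKn ?leq_ord// !mulrnAl.
have pz := poly_eq0_nat pE.
have := congr1 (fun q : {poly R} => q`_(n - j)) pz.
rewrite coef_poly coef0 ltnS leq_subr subKn// => /eqP.
rewrite mulrn_eq0 mulf_eq0 signr_eq0 orbF => /orP[|/eqP//].
by rewrite -leqn0 leqNgt bin_gt0 lejn.
Qed.

(** Only the top term of the expansion survives: once the lower moments vanish, the next one is
    insensitive to translation. *)
Lemma shifted_moment S e a n X :
  (forall j, (j <= n)%N -> \sum_(i in S) e i * a i ^+ j = 0) ->
  \sum_(i in S) e i * (X - a i) ^+ n.+1 =
  (-1) ^+ n.+1 * \sum_(i in S) e i * a i ^+ n.+1.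
Proof.
move=> h; rewrite expand_moments big_ord_recr /= big1 => [|j _].
  by rewrite add0r subnn expr0 mulr1 binn mulr1n mulrC.
by rewrite h ?leq_ord// !mul0r mul0rn.
Qed.

(** Telescopes [(t + 1) ^ n.+1 - t ^ n.+1] over [1 <= t <= L]; this recursion stands in for closed
    Faulhaber formulas. *)
Lemma telescope_power n (L : nat) :
  (L.+1%:R : R) ^+ n.+1 = 1 + \sum_(l < n.+1) (\sum_(1 <= t < L.+1) t%:R ^+ l) *+ 'C(n.+1, l).
Proof.
elim: L => [|L IH].
  by rewrite big1 ?addr0 ?expr1n// => l _; rewrite big_geq// mul0rn.
rewrite -[L.+2%:R]natr1 addrC exprDn big_ord_recr /= subnn expr0 mul1r binn mulr1n.
rewrite addrC IH -addrA; congr (_ + _); rewrite -big_split /=; apply: eq_bigr => l _.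
by rewrite [in RHS]big_nat_recr//= mulrnDl expr1n mul1r.
Qed.

(** In the recursion for power sums each lower exponent contributes, by induction, a moment of order
    at most [n], which vanishes. Only [(L i + 1) ^ n.+1] remains, and [shifted_moment] removes its
    dependence on [X]. *)
Lemma weighted_power_sum S e a n X (L : I -> nat) :
  (forall j, (j <= n)%N -> \sum_(i in S) e i * a i ^+ j = 0) ->
  (forall i, i \in S -> (L i)%:R = X - a i) ->
  \sum_(i in S) e i * \sum_(1 <= t < (L i).+1) t%:R ^+ n =
  (-1) ^+ n.+1 * (\sum_(i in S) e i * a i ^+ n.+1) / n.+1%:R.
Proof.
elim/ltn_ind: n => n IH h hL.
have H : \sum_(i in S) e i * (X + 1 - a i) ^+ n.+1 =
    n.+1%:R * \sum_(i in S) e i * \sum_(1 <= t < (L i).+1) t%:R ^+ n.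
  under eq_bigr => i iS.
    rewrite addrAC -hL// natr1 telescope_power mulrDr mulr1 big_ord_recr /= mulrDr.
    over.
  have h0 : \sum_(i in S) e i = 0.
    by rewrite -[RHS](h 0%N isT); apply: eq_bigr => i _; rewrite expr0 mulr1.
  rewrite !big_split /= h0 add0r.
  under [X in X + _ = _]eq_bigr do rewrite mulr_sumr.
  rewrite exchange_big /= big1 ?add0r => [|l _].
    by rewrite mulr_sumr; apply: eq_bigr => i _; rewrite binSn mulrnAr mulr_natl.
  under eq_bigr do rewrite mulrnAr.
  rewrite sumrMnl (IH l)//; last by move=> j jl; apply: h; rewrite (leq_trans jl)// ltnW.
  by rewrite h ?ltn_ord// mulr0 mul0r mul0rn.
rewrite -(shifted_moment (X + 1) h) H mulrC mulKf// pnatr_eq0//.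
Qed.

End Moments.

(** * Flipping the edges of a vertex cone *)

Section SignIdentity.
Variables (R : realType) (I : finType).
Implicit Types (S : {set I}) (a lam : I -> R).

Lemma exists_argmin S a x : x \in S -> exists2 p, p \in S & forall w, w \in S -> a p <= a w.
Proof. by move=> xS; case: (Order.TotalTheory.arg_minP a xS) => p pS h; exists p. Qed.

Lemma exists_argmax S a x : x \in S -> exists2 p, p \in S & forall w, w \in S -> a w <= a p.
Proof. by move=> xS; case: (Order.TotalTheory.arg_maxP a xS) => p pS h; exists p. Qed.

(** The parity of the number of edges at [v] to be reversed so that all point upwards. *)
Definition flip_sign S a v : R := \prod_(w in S :\ v) Num.sg (a w - a v).
(** Here [lam] are barycentric coordinates: [lam w] is the coefficient along the edge from [v] to
    [w], and reversing a descending edge reverses the sign required of it. Walls are excluded. *)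
Definition in_flipped_cone S a lam v := [forall w in S :\ v, 0 < lam w * (a w - a v)].

Lemma sgr_eq_mul_gt0 (x y : R) : 0 < x * y -> Num.sg y = Num.sg x.
Proof.
case: (ltrgt0P x) => [x0|x0|->]; last by rewrite mul0r ltxx.
- by rewrite pmulr_rgt0// => /gtr0_sg ->; rewrite gtr0_sg.
- by rewrite nmulr_rgt0// => /ltr0_sg ->; rewrite ltr0_sg.
Qed.

Lemma flip_signE S a lam v : in_flipped_cone S a lam v ->
  flip_sign S a v = \prod_(w in S :\ v) Num.sg (lam w).
Proof. by move=> /forall_inP h; apply: eq_bigr => w /h/sgr_eq_mul_gt0. Qed.

(** If all weights are positive, only the cone of the lowest vertex contains the point. Otherwise
    let [p] be the highest vertex of negative weight and [q] the lowest of positive weight. Any apex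
    but [p] must lie above [p], any apex but [q] below [q], so a third one would contradict the
    choice of [p] or [q]. Either no cone contains the point, or exactly those of [p] and [q] do,
    with opposite signs. *)
Lemma flipped_cone_sum S a lam t : (1 < #|S|)%N ->
  {in S &, injective a} -> {in S, forall i, lam i != 0} ->
  \sum_(i in S) lam i = 1 -> \sum_(i in S) lam i * a i = t ->
  \sum_(v in S | a v < t) flip_sign S a v * (in_flipped_cone S a lam v)%:R =
  [forall w in S, 0 < lam w]%:R.
Proof.
move=> S2 ainj lam0 lam1 tE.
have tB v : t - a v = \sum_(i in S) lam i * (a i - a v).
  rewrite -tE -[a v in LHS]mul1r -lam1 mulr_suml -sumrB.
  by apply: eq_bigr => i _; rewrite mulrBr.
have altS u v : u \in S -> v \in S -> u != v -> a u <= a v -> a u < a v.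
  move=> uS vS uv; rewrite le_eqVlt => /orP[/eqP/ainj|//].
  by move=> /(_ uS vS) uve; rewrite uve eqxx in uv.
case: (boolP [forall w in S, 0 < lam w]) => [/forall_inP lamp|].
  have /card_gt0P[x xS] : (0 < #|S|)%N by rewrite ltnW.
  have [p pS pmin] := exists_argmin a xS.
  have pt : a p < t.
    have /card_gt0P[w] : (0 < #|S :\ p|)%N by rewrite (cardsD1 p) pS in S2.
    rewrite !inE => /andP[wp wS].
    rewrite -subr_gt0 tB (bigD1 w)//= ltr_wpDr//.
      by apply: sumr_ge0 => i /andP[iS _]; rewrite mulr_ge0 ?subr_ge0 ?pmin ?ltW ?lamp.
    by rewrite mulr_gt0 ?lamp// subr_gt0 altS ?pmin// eq_sym.
  rewrite (bigD1 p) ?pS//= [X in _ + X]big1 => [|v /andP[/andP[vS _] vp]].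
    rewrite addr0; have cp : in_flipped_cone S a lam p.
      apply/forall_inP => w; rewrite !inE => /andP[wp wS].
      by rewrite mulr_gt0 ?lamp// subr_gt0 altS ?pmin// eq_sym.
    rewrite cp mulr1 (flip_signE cp) big1// => w; rewrite !inE => /andP[_ wS].
    by rewrite gtr0_sg ?lamp.
  case: (boolP (in_flipped_cone _ _ _ _)) => [/forall_inP/(_ p)|]; last by rewrite mulr0.
  rewrite !inE eq_sym vp pS => /(_ isT); rewrite pmulr_rgt0 ?lamp// subr_gt0 => h.
  by have := le_lt_trans (pmin _ vS) h; rewrite ltxx.
rewrite negb_forall_in => /exists_inP[x xS xneg].
have {}xneg : lam x < 0 by rewrite lt_neqAle lam0//= leNgt.
have [y /andP[yS ypos]] : exists y, (y \in S) && (0 < lam y).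
  apply/existsP; apply: contraT; rewrite negb_exists => /forallP h.
  have : \sum_(i in S) lam i <= 0.
    by apply: sumr_le0 => i iS; have := h i; rewrite iS/= -leNgt.
  by rewrite lam1 ler10.
have [|p] := @exists_argmax [set w in S | lam w < 0] a x; first by rewrite inE xS.
rewrite inE => /andP[pS pneg] pmax.
have [|q] := @exists_argmin [set w in S | 0 < lam w] a y; first by rewrite inE yS.
rewrite inE => /andP[qS qpos] qmin.
have {}pmax w : w \in S -> lam w < 0 -> a w <= a p by move=> wS wn; apply: pmax; rewrite inE wS.
have {}qmin w : w \in S -> 0 < lam w -> a q <= a w by move=> wS wn; apply: qmin; rewrite inE wS.
have pq : p != q by apply: contraTneq pneg => ->; rewrite -leNgt ltW.
have conep v : v \in S -> v != p -> in_flipped_cone S a lam v -> a p < a v.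
  move=> vS vp /forall_inP/(_ p); rewrite !inE pS eq_sym vp => /(_ isT).
  by rewrite nmulr_rgt0// subr_lt0.
have coneq v : v \in S -> v != q -> in_flipped_cone S a lam v -> a v < a q.
  move=> vS vp /forall_inP/(_ q); rewrite !inE qS eq_sym vp => /(_ isT).
  by rewrite pmulr_rgt0// subr_gt0.
have [apq|apq] := ltP (a p) (a q); last first.
  rewrite big1// => v /andP[vS _].
  case: (boolP (in_flipped_cone _ _ _ _)) => [h|]; last by rewrite mulr0.
  have [vp|vp] := eqVneq v p.
    by have := coneq v vS; rewrite vp => /(_ pq); rewrite -vp => /(_ h); rewrite vp ltNge apq.
  have [vq|vq] := eqVneq v q; first by have := conep v vS vp h; rewrite vq ltNge apq.
  by have := lt_trans (conep v vS vp h) (coneq v vS vq h); rewrite ltNge apq.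
have cp : in_flipped_cone S a lam p.
  apply/forall_inP => w; rewrite !inE => /andP[wp wS].
  case: (ltrgt0P (lam w)) (lam0 _ wS) => // [w0|w0] _.
    by rewrite pmulr_rgt0// subr_gt0 (lt_le_trans apq)// qmin.
  by rewrite nmulr_rgt0// subr_lt0 altS// pmax.
have cq : in_flipped_cone S a lam q.
  apply/forall_inP => w; rewrite !inE => /andP[wp wS].
  case: (ltrgt0P (lam w)) (lam0 _ wS) => // [w0|w0] _.
    by rewrite pmulr_rgt0// subr_gt0 altS ?qmin// eq_sym.
  by rewrite nmulr_rgt0// subr_lt0 (le_lt_trans (pmax w wS w0)).
(* Every term of [t - a q] is nonnegative: positive weights sit at or above [q], negative ones at or
   below [p], hence below [q]. So the condition [a v < t] excludes neither [p] nor [q]. *)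
have qt : a q < t.
  rewrite -subr_gt0 tB (bigD1 p)//= ltr_wpDr//; last first.
    by rewrite nmulr_rgt0// subr_lt0.
  apply: sumr_ge0 => w /andP[wS wp].
  case: (ltrgt0P (lam w)) (lam0 _ wS) => // [w0|w0] _.
    by rewrite pmulr_rge0// subr_ge0 qmin.
  by rewrite nmulr_rge0// subr_le0 ltW// (le_lt_trans (pmax w wS w0)).
rewrite (bigD1 p) ?pS ?(lt_trans apq)//= (bigD1 q) ?qS ?qt ?(eq_sym q) ?pq//=.
rewrite cp cq !mulr1 [X in _ + (_ + X)]big1 => [|v /andP[/andP[/andP[vS _] vp] vq]].
  have hS v : v \in S -> \prod_(w in S) Num.sg (lam w) =
      Num.sg (lam v) * \prod_(w in S :\ v) Num.sg (lam w).
    by move=> vS; rewrite (big_setD1 v).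
  have := etrans (esym (hS q qS)) (hS p pS).
  rewrite -(flip_signE cp) -(flip_signE cq) (ltr0_sg pneg) (gtr0_sg qpos) => h.
  by rewrite addr0; lra.
case: (boolP (in_flipped_cone _ _ _ _)) => [h|]; last by rewrite mulr0.
have h1 := conep v vS vp h; have h2 := coneq v vS vq h.
case: (ltrgt0P (lam v)) (lam0 _ vS) => // [w0|w0] _.
  by have := qmin v vS w0; rewrite leNgt h2.
by have := pmax v vS w0; rewrite leNgt h1.
Qed.

End SignIdentity.

(** * Sums over shifted lattices, and lattice-face position *)

Section LatticeSum.
Variable R : realType.
Implicit Types (h : R) (B d : nat) (g : (nat -> R) -> R) (y z : nat -> R).

Definition scons (x : R) y : nat -> R := fun k => if k is k'.+1 then y k' else x.

(** The first coordinate is outermost, so slicing by it is definitional; only the last, innermost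
    one is shifted. The shift [h] is [2^-1] for the counts [N] and [0] for ordinary lattice points;
    [B] truncates the lattice to a box. *)
Fixpoint lattice_sum h B d g : R :=
  match d with
  | 0 => g (fun=> 0)
  | d'.+1 => \sum_(i < B.*2.+1)
      lattice_sum h B d'
        (fun y => g (scons (i%:R - B%:R - (if d' is 0 then h else 0)) y))
  end.

Definition shifted_lattice h d z :=
  forall k, (k < d)%N -> z k + (if k.+1 == d then h else 0) \is a Num.int.

Lemma int_subnat (i B : nat) : i%:R - B%:R \is a @Num.int R.
Proof. by rewrite rpredB// natr_int. Qed.

Lemma shifted_lattice_scons h d x y :
  x + (if d is 0 then h else 0) \is a Num.int -> shifted_lattice h d y ->
  shifted_lattice h d.+1 (scons x y).
Proof.
move=> xint yint [|k]; first by rewrite eqSS; case: d xint {yint}.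
by rewrite ltnS /= => kd; rewrite eqSS yint.
Qed.

Lemma eq_lattice_sum h B d g g' :
  (forall z, shifted_lattice h d z -> g z = g' z) ->
  lattice_sum h B d g = lattice_sum h B d g'.
Proof.
elim: d g g' => [|d IH] g g' gg' /=; first by apply: gg'.
apply: eq_bigr => i _; apply: IH => y yint; apply: gg'.
by apply: shifted_lattice_scons => //; rewrite subrK int_subnat.
Qed.

Lemma ler_lattice_sum h B d g g' :
  (forall z, shifted_lattice h d z -> g z <= g' z) ->
  lattice_sum h B d g <= lattice_sum h B d g'.
Proof.
elim: d g g' => [|d IH] g g' gg' /=; first by apply: gg'.
apply: ler_sum => i _; apply: IH => y yint; apply: gg'.
by apply: shifted_lattice_scons => //; rewrite subrK int_subnat.
Qed.

Lemma lattice_sum0 h B d g :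
  (forall z, shifted_lattice h d z -> g z = 0) -> lattice_sum h B d g = 0.
Proof.
elim: d g => [|d IH] g g0 /=; first by apply: g0.
rewrite big1// => i _; apply: IH => y yint; apply: g0.
by apply: shifted_lattice_scons => //; rewrite subrK int_subnat.
Qed.

Lemma lattice_sum_lin h B d (J : Type) (r : seq J) (Q : pred J) (c : J -> R)
    (g_ : J -> (nat -> R) -> R) :
  lattice_sum h B d (fun z => \sum_(j <- r | Q j) c j * g_ j z) =
  \sum_(j <- r | Q j) c j * lattice_sum h B d (g_ j).
Proof.
elim: d g_ => [//|d IH] g_ /=.
under eq_bigr do rewrite IH.
by rewrite exchange_big /=; apply: eq_bigr => j _; rewrite mulr_sumr.
Qed.

(** Passing from [B] to [B.+1] adds the nodes [- B.+1 - h] and [B.+1 - h]; as [0 <= h <= 1], both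
    have absolute value at least [B]. *)
Lemma shrink_sum h A B (F : R -> R) : 0 <= h <= 1 -> (A <= B)%N ->
  (forall t, A%:R <= `|t| -> F t = 0) ->
  \sum_(i < B.*2.+1) F (i%:R - B%:R - h) = \sum_(i < A.*2.+1) F (i%:R - A%:R - h).
Proof.
move=> /andP[h0 h1] + F0; elim: B => [|B IH]; first by rewrite leqn0 => /eqP ->.
rewrite leq_eqVlt => /orP[/eqP ->//|]; rewrite ltnS => AB.
have AB' : A%:R <= B%:R :> R by rewrite ler_nat.
have B0 := ler0n R B.
rewrite -IH// doubleS big_ord_recl big_ord_recr /= F0; last first.
  by rewrite sub0r -natr1 ler0_norm; lra.
rewrite add0r [X in _ + X]F0 ?addr0; last first.
  rewrite /bump /= add1n -[B.*2.+2]/(B.+1.*2) -mul2n natrM -[B.+1%:R]natr1.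
  by rewrite ger0_norm; lra.
by apply: eq_bigr => i _; rewrite /bump /= add1n -!natr1; congr (F _); ring.
Qed.

Lemma shrink_lattice_sum h A B d g : 0 <= h <= 1 -> (A <= B)%N ->
  (forall z k, (k < d)%N -> A%:R <= `|z k| -> g z = 0) ->
  lattice_sum h B d g = lattice_sum h A d g.
Proof.
move=> h01 AB; elim: d g => [//|d IH] g g0 /=.
pose F t := lattice_sum h A d (fun y => g (scons t y)).
have d01 : 0 <= (if d is 0 then h else 0) <= 1 by case: (d); rewrite ?lexx ?ler01.
transitivity (\sum_(i < B.*2.+1) F (i%:R - B%:R - (if d is 0 then h else 0))).
  apply: eq_bigr => i _; apply: IH => z k kd zk.
  by apply: (g0 _ k.+1).
apply: shrink_sum => // t tA; apply: lattice_sum0 => z _.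
by apply: (g0 _ 0%N).
Qed.

End LatticeSum.

Section Hull.
Variables (R : realType) (I : finType).
Implicit Types (S U : {set I}) (v : I -> nat -> R) (z : nat -> R) (d : nat).

Definition is_weight d S v z (lam : I -> R) :=
  [/\ forall i, 0 <= lam i, forall i, i \notin S -> lam i = 0, \sum_i lam i = 1
    & forall k, (k < d)%N -> \sum_i lam i * v i k = z k].

Definition inhull d S v z := exists lam, is_weight d S v z lam.

Definition hull_ind d S v z : R := (`[< inhull d S v z >])%:R.

Definition coord_bound d v : nat :=
  (\sum_i \sum_(k < d) (Num.truncn `|v i k|).+1)%N.

Lemma coord_boundP d v i k : (k < d)%N -> `|v i k| < (coord_bound d v)%:R.
Proof.
move=> kd; apply: (lt_le_trans (truncnS_gt _)); rewrite ler_nat /coord_bound.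
by rewrite (bigD1 i)//= (bigD1 (Ordinal kd))//= -addnA leq_addr.
Qed.

Lemma hull_bound d S v z k (A : R) : inhull d S v z -> (k < d)%N ->
  (forall i, i \in S -> `|v i k| < A) -> `|z k| < A.
Proof.
move=> [lam [lam0 lamS lam1 lamz]] kd vA; rewrite -lamz//.
apply: (le_lt_trans (ler_norm_sum _ _ _)).
rewrite -[A]mul1r -lam1 mulr_suml.
have [i lami] : exists i, 0 < lam i.
  apply: contrapT => h; suff : \sum_i lam i = 0 by rewrite lam1 => /eqP; rewrite oner_eq0.
  apply: big1 => i _; apply/eqP; rewrite eq_le lam0 andbT leNgt.
  by apply/negP => hi; apply: h; exists i.
have term j : `|lam j * v j k| <= lam j * A.
  rewrite normrM ger0_norm//; have [jS|jS] := boolP (j \in S).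
    by rewrite ler_wpM2l// ltW// vA.
  by rewrite lamS// !mul0r.
rewrite (bigD1 i)//= [ltRHS](bigD1 i)//= ltr_leD//; last by apply: ler_sum.
rewrite normrM ger0_norm// ltr_pM2l// vA//.
by apply: contraLR lami => /lamS ->; rewrite ltxx.
Qed.

Lemma shrink_hull_sum h d S v A B : 0 <= h <= 1 ->
  (forall i k, (k < d)%N -> `|v i k| < A%:R) -> (A <= B)%N ->
  lattice_sum h B d (hull_ind d S v) = lattice_sum h A d (hull_ind d S v).
Proof.
move=> h01 vA AB; apply: shrink_lattice_sum => // z k kd zA.
rewrite /hull_ind asboolF// => zh.
by have := hull_bound zh kd (fun i _ => vA i k kd); rewrite ltNge zA.
Qed.

Definition half_count d S v : R :=
  lattice_sum 2^-1 (coord_bound d v) d (hull_ind d S v).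

Lemma half01 : 0 <= (2^-1 : R) <= 1. Proof. by apply/andP; split; lra. Qed.

Lemma half_countE d S v B : (coord_bound d v <= B)%N ->
  lattice_sum 2^-1 B d (hull_ind d S v) = half_count d S v.
Proof. by move=> h; apply: shrink_hull_sum => // [|i k]; [exact: half01|exact: coord_boundP]. Qed.

Definition indep d U v := forall eta : I -> R,
  (forall i, i \notin U -> eta i = 0) -> \sum_i eta i = 0 ->
  (forall k, (k < d)%N -> \sum_i eta i * v i k = 0) -> forall i, eta i = 0.

Definition int_affine_on k U v := exists c0 (c : nat -> R),
  [/\ c0 \is a Num.int, forall j, c j \is a Num.int
    & forall u, u \in U -> v u k = c0 + \sum_(j < k) c j * v u j].

(* Conditions (a) and (b) of lattice-face polytopes, unfolded over all dimensions. *)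
Definition lattice_general d S v := forall k U, (k < d)%N -> U \subset S ->
  (#|U| <= k.+1)%N -> indep k U v /\ int_affine_on k U v.

End Hull.

(** * Slices of the flipped cones of a simplex *)

Section Simplex.
Variables (R : realType) (I : finType).
Implicit Types (S U : {set I}) (v : I -> nat -> R) (z y : nat -> R) (d : nat).

Definition is_affine_comb d S v z (lam : I -> R) :=
  [/\ forall i, i \notin S -> lam i = 0, \sum_i lam i = 1
    & forall k, (k < d)%N -> \sum_i lam i * v i k = z k].

Lemma sum_supp S (F : I -> R) : (forall i, i \notin S -> F i = 0) ->
  \sum_i F i = \sum_(i in S) F i.
Proof.
by move=> FS; rewrite (bigID [in S]) /= [X in _ + X]big1 ?addr0.
Qed.

Lemma affine_comb_unique d S v z lam lam' : indep d S v ->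
  is_affine_comb d S v z lam -> is_affine_comb d S v z lam' -> lam =1 lam'.
Proof.
move=> ind [l0 l1 lz] [l0' l1' lz'] i; apply/eqP; rewrite -subr_eq0; apply/eqP.
apply: (ind (fun i => lam i - lam' i)) => [j jS||k kd].
- by rewrite l0// l0'// subrr.
- by rewrite sumrB l1 l1' subrr.
- by under eq_bigr do rewrite mulrBl; rewrite sumrB lz// lz'// subrr.
Qed.

(* The span is the graph of an integral affine function over the first [d]
   coordinates, while the last coordinate of [z] is a half-integer. *)
Lemma half_lattice_not_in_span d S U v z lam : lattice_general d.+1 S v ->
  U \subset S -> (#|U| <= d.+1)%N -> shifted_lattice 2^-1 d.+1 z ->
  ~ is_affine_comb d.+1 U v z lam.
Proof.
move=> gen US Ud zint [lamU lam1 lamz].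
have [_ [c0 [c [c0int cint cU]]]] := gen d U (ltnSn d) US Ud.
have zd : z d = c0 + \sum_(j < d) c j * z j.
  rewrite -lamz// (eq_bigr (fun i => lam i * c0 + \sum_(j < d) lam i * c j * v i j)).
    rewrite big_split /= -mulr_suml lam1 mul1r; congr (_ + _).
    rewrite exchange_big /=; apply: eq_bigr => j _.
    rewrite -lamz; last by rewrite (ltn_trans (ltn_ord j)).
    by rewrite mulr_sumr; apply: eq_bigr => i _; ring.
  move=> i _; have [iU|iU] := boolP (i \in U).
    by rewrite cU// mulrDr mulr_sumr; congr (_ + _); apply: eq_bigr => j _; rewrite mulrA.
  by rewrite lamU// !mul0r big1 ?addr0// => j _; rewrite !mul0r.
have zdint : z d \is a Num.int.
  rewrite zd rpredD// rpred_sum// => j _; rewrite rpredM//.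
  have := zint j; rewrite eqSS ltnS (ltnW (ltn_ord j)) => /(_ isT).
  by rewrite (ltn_eqF (ltn_ord j)) addr0.
have := zint d (ltnSn d); rewrite eqxx => half_int.
have {half_int}/intrP[n nE] : (2^-1 : R) \is a Num.int by rewrite -[2^-1](addKr (z d)) rpredD// rpredN.
have /eqP : (n * 2)%:~R = 1 :> R by rewrite intrM -nE mulVf ?pnatr_eq0.
by rewrite (eqr_int _ _ 1) => /eqP; lia.
Qed.

(* The point where the line through [v a] and [v i] meets [x_1 = t], with the
   first coordinate dropped. *)
Definition edge_slice v a t : I -> nat -> R := fun i k =>
  v a k.+1 + (t - v a 0%N) / (v i 0%N - v a 0%N) * (v i k.+1 - v a k.+1).

(** The case [k = 1] of general position: two points sharing their first coordinate would be
    affinely dependent on the line. *)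
Lemma lattice_general_inj d S v : lattice_general d.+2 S v ->
  {in S &, injective (fun i => v i 0%N)}.
Proof.
move=> gen i j iS jS vij; apply/eqP/negPn/negP => ij.
have US : [set i; j] \subset S by apply/fintype.subsetP => x; rewrite !inE => /orP[]/eqP->.
have [|ind _] := gen 1%N _ isT US; first by rewrite cards2 ij.
pose eta x : R := (x == i)%:R - (x == j)%:R.
have sumE (F : I -> R) : \sum_x eta x * F x = F i - F j.
  under eq_bigr do rewrite mulrBl.
  rewrite sumrB (bigD1 i)//= eqxx mul1r big1 ?addr0; last first.
    by move=> x /negPf ->; rewrite mul0r.
  rewrite (bigD1 j)//= eqxx mul1r big1 ?addr0// => x /negPf ->; exact: mul0r.
have eta0 : eta i = 0.
  apply: ind => [x||[|//] _].
  - by rewrite !inE negb_or /eta => /andP[/negPf -> /negPf ->]; rewrite subrr.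
  - by have := sumE (fun=> 1); under eq_bigr do rewrite mulr1; rewrite subrr.
  - by rewrite sumE vij subrr.
by move/eqP: eta0; rewrite /eta eqxx (negPf ij) subr0 oner_eq0.
Qed.

Section VertexCone.
Variables (d : nat) (S : {set I}) (v : I -> nat -> R) (a : I) (t : R).
Hypotheses (vinj : {in S &, injective (fun i => v i 0%N)}) (aS : a \in S).
Hypothesis (at_ : v a 0%N < t).

Let s i := v i 0%N - v a 0%N.
Let tau := t - v a 0%N.

Let tau0 : tau != 0. Proof. by rewrite subr_eq0 gt_eqF. Qed.

Let s0 i : i \in S :\ a -> s i != 0.
Proof.
rewrite !inE => /andP[ia iS]; rewrite subr_eq0; apply: contra ia => /eqP h.
by apply/eqP; apply: vinj.
Qed.

Let sumDl (lam : I -> R) f : (forall i, i \notin S -> lam i = 0) -> \sum_i lam i = 1 ->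
  \sum_(i in S :\ a) lam i * (f i - f a) = \sum_i lam i * f i - f a.
Proof.
move=> lamS lam1; rewrite -[f a in RHS]mul1r -lam1 mulr_suml -sumrB.
rewrite [RHS](sum_supp (S := S :\ a)) => [|i].
  by apply: eq_bigr => i _; rewrite mulrBr.
rewrite !inE negb_and negbK => /orP[/eqP ->|/lamS ->]; first by rewrite subrr.
by rewrite !mul0r subrr.
Qed.

(** The point at parameter [tau / s i] on the line of edge [i] gives [mu i * tau / s i] to the
    vertex [i] and the rest to the apex. Multiplied by [s i] this is [mu i * tau], nonnegative
    whether the edge ascends or descends. *)
Lemma affine_of_edge_slice y (mu : I -> R) :
  is_weight d (S :\ a) (edge_slice v a t) y mu ->
  exists2 lam, is_affine_comb d.+1 S v (scons t y) lam &
    forall i, i \in S :\ a -> 0 <= lam i * s i.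
Proof.
move=> [mu0 muS mu1 muy].
pose nu i := mu i * tau / s i.
pose lam i := if i == a then 1 - \sum_(j in S :\ a) nu j else nu i.
have lamE i : i \in S :\ a -> lam i = nu i by rewrite !inE /lam => /andP[/negPf ->].
have lamS i : i \notin S -> lam i = 0.
  move=> iS; rewrite /lam; case: eqP => [ia|_]; first by rewrite ia aS in iS.
  by rewrite /nu muS ?mul0r// !inE (negPf iS) andbF.
have lam1 : \sum_i lam i = 1.
  rewrite (sum_supp lamS) (big_setD1 a)//= {1}/lam eqxx.
  by rewrite [X in _ + X](eq_bigr nu) ?subrK// => i; apply: lamE.
have muSa : \sum_(i in S :\ a) mu i = 1 by rewrite -mu1 [RHS](sum_supp muS).
exists lam => [|i iS]; last first.
  by rewrite lamE// divfK ?s0// mulr_ge0// /tau subr_ge0 ltW.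
split=> // k kd; apply/eqP; rewrite -[_ == _](inj_eq (addIr (- v a k))) -sumDl//.
apply/eqP; case: k kd => [|k] kd /=.
  rewrite (eq_bigr (fun i => mu i * tau)).
    by rewrite -mulr_suml muSa mul1r.
  by move=> i iS; rewrite lamE// divfK ?s0.
have := muy k kd.
rewrite (sum_supp (S := S :\ a)) => [<-|i /muS ->]; last by rewrite mul0r.
rewrite -[v a k.+1 in RHS]mul1r -muSa mulr_suml -sumrB; apply: eq_bigr => i iS.
by rewrite lamE// /nu /edge_slice -/tau -/(s i); ring.
Qed.

Lemma edge_slice_of_affine y (lam : I -> R) :
  is_affine_comb d.+1 S v (scons t y) lam ->
  (forall i, i \in S :\ a -> 0 <= lam i * s i) ->
  inhull d (S :\ a) (edge_slice v a t) y.
Proof.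
move=> [lamS lam1 lamz] lam0.
pose mu i := if i \in S :\ a then lam i * s i / tau else 0.
have muS i : i \notin S :\ a -> mu i = 0 by rewrite /mu => /negPf ->.
have tau_gt0 : 0 < tau by rewrite subr_gt0.
have mu1 : \sum_(i in S :\ a) mu i = 1.
  rewrite (eq_bigr (fun i => lam i * s i / tau)) => [|i iS]; last by rewrite /mu iS.
  by rewrite -mulr_suml sumDl// lamz//= divff.
exists mu; split=> //.
- move=> i; rewrite /mu; case: ifP => // iS.
  by rewrite divr_ge0 ?lam0// ltW.
- by rewrite (sum_supp muS).
move=> k kd; rewrite (sum_supp (S := S :\ a)) => [|i /muS ->]; last by rewrite mul0r.
have -> : y k = \sum_(i in S :\ a) mu i * v a k.+1 +
    \sum_(i in S :\ a) lam i * (v i k.+1 - v a k.+1).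
  by rewrite -mulr_suml mu1 mul1r sumDl// lamz//= addrC subrK.
rewrite -big_split /=; apply: eq_bigr => i iS.
rewrite /mu iS /edge_slice -/tau -/(s i); field.
by rewrite tau0 s0.
Qed.

(** Dividing a dependency of the slice by the [s i] and balancing at [a] lifts it to [a |: U]: the
    vanishing total becomes the equation for coordinate [0]. *)
Lemma indep_edge_slice k U : U \subset S :\ a -> indep k.+1 (a |: U) v ->
  indep k U (edge_slice v a t).
Proof.
move=> US ind.
have aU : a \notin U by apply/negP => /(fintype.subsetP US); rewrite !inE eqxx.
have Us i : i \in U -> s i != 0 by move=> /(fintype.subsetP US); exact: s0.
have Ua i : i \in U -> i != a by move=> iU; apply: contraNneq aU => <-.
move=> eta etaU eta1 etak i; have [iU|/etaU//] := boolP (i \in U).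
pose nu i := eta i / s i.
pose lam i := if i == a then - \sum_(j in U) nu j else nu i.
have lamE j : j \in U -> lam j = nu j by move=> jU; rewrite /lam (negPf (Ua _ jU)).
have nuU j : j \notin U -> nu j = 0 by move=> /etaU h; rewrite /nu h mul0r.
have lamU j : j \notin a |: U -> lam j = 0.
  by rewrite !inE negb_or /lam => /andP[/negPf -> /nuU].
have lamsum f : \sum_j lam j * f j = \sum_(j in U) nu j * (f j - f a).
  rewrite (sum_supp (S := a |: U)) => [|j /lamU ->]; last by rewrite mul0r.
  rewrite big_setU1//= {1}/lam eqxx mulNr mulr_suml -sumrN -big_split /=.
  by apply: eq_bigr => j jU; rewrite lamE//; ring.
have : lam i = 0.
  apply: (ind lam lamU) => [|l lk].
    have := lamsum (fun=> 1); under eq_bigr do rewrite mulr1.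
    by move=> ->; rewrite big1// => j _; rewrite subrr mulr0.
  rewrite lamsum; case: l lk => [|l] lk.
    rewrite -[RHS]eta1 (sum_supp etaU); apply: eq_bigr => j jU.
    by rewrite /nu divfK ?Us.
  apply: (mulfI tau0); rewrite mulr0.
  have := etak l lk; rewrite (sum_supp (S := U)) => [|j /etaU ->]; last by rewrite mul0r.
  move=> h; rewrite -[RHS]h mulr_sumr.
  have E : 0 = \sum_(j in U) eta j * v a l.+1.
    by rewrite -mulr_suml -(sum_supp etaU) eta1 mul0r.
  rewrite -[LHS]add0r {1}E -big_split /=; apply: eq_bigr => j jU.
  by rewrite /nu /edge_slice -/tau -/(s j); ring.
rewrite lamE// /nu => /eqP; rewrite mulf_eq0 invr_eq0 (negPf (Us _ iU)) orbF => /eqP//.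
Qed.

(** The integral relation for coordinate [k.+1] on [a |: U] is affine, so it persists on the lines
    of the edges. At [x_1 = t] its term in the first coordinate is the integer [c 0 * t], absorbed
    in the constant. *)
Lemma lattice_general_edge_slice : t \is a Num.int -> lattice_general d.+1 S v ->
  lattice_general d (S :\ a) (edge_slice v a t).
Proof.
move=> tint gen k U kd US Uk.
have UaS : a |: U \subset S.
  by rewrite finset.subUset finset.sub1set aS (fintype.subset_trans US)// finset.subD1set.
have aU : a \notin U by apply/negP => /(fintype.subsetP US); rewrite !inE eqxx.
have [|ind [c0 [c [c0int cint cU]]]] := gen k.+1 _ kd UaS; first by rewrite cardsU1 aU ltnS.
split; first exact: indep_edge_slice.
have Us i : i \in U -> s i != 0 by move=> /(fintype.subsetP US); exact: s0.
exists (c0 + c 0%N * t), (fun j => c j.+1); split=> //.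
  by rewrite rpredD// rpredM.
move=> u uU; rewrite /edge_slice -/tau -/(s u).
rewrite (cU a) ?setU11// (cU u) ?setU1r// !big_ord_recl /=.
have -> : \sum_(j < k) c j.+1 * (v a j.+1 + tau / s u * (v u j.+1 - v a j.+1)) =
  \sum_(j < k) c j.+1 * v a j.+1 + tau / s u *
   (\sum_(j < k) c j.+1 * v u j.+1 - \sum_(j < k) c j.+1 * v a j.+1).
  rewrite -sumrB mulr_sumr -big_split /=; apply: eq_bigr => j _; ring.
have bumpE w : \sum_(j < k) c (bump 0 j) * v w (bump 0 j) =
  \sum_(j < k) c j.+1 * v w j.+1 by apply: eq_bigr.
rewrite !bumpE.
have -> : t = v a 0%N + tau by rewrite /tau addrC subrK.
have := Us _ uU; rewrite /s => h; field.
by [].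
Qed.

End VertexCone.
End Simplex.

(** * Counting in a simplex *)

Section Counting1D.
Variable R : realType.

Lemma sum_above (B p : nat) (F : nat -> R) : (p <= B.*2)%N ->
  \sum_(i < B.*2.+1) (p < i)%:R * F (i - p)%N = \sum_(1 <= l < (B.*2 - p).+1) F l.
Proof.
move=> pB; rewrite -(big_mkord predT (fun i => (p < i)%:R * F (i - p)%N)).
rewrite (@big_cat_nat _ _ _ p.+1)//= big_nat_cond big1 ?add0r => [|i /andP[/andP[_]]]; last first.
  by rewrite ltnS leqNgt => /negPf -> _; rewrite mul0r.
rewrite -add1n big_addn subSn// ; apply: eq_big_nat => i /andP[i0 _].
by rewrite addnK -[X in (X < _)%N]add0n ltn_add2r i0 mul1r.
Qed.

Lemma int_subnatP (x : R) (B : nat) : x \is a Num.int -> `|x| <= B%:R ->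
  exists2 p : nat, (p <= B.*2)%N & x = p%:R - B%:R.
Proof.
move=> xint; rewrite ler_norml => /andP[h1 h2].
have /natrP[p pE] : x + B%:R \is a Num.nat.
  by rewrite natrEint rpredD ?natr_int//=; lra.
by exists p; rewrite -?(ler_nat R) -?mul2n ?natrM -pE; lra.
Qed.

Lemma sum_above_int (B : nat) (x : R) n : x \is a Num.int -> `|x| <= B%:R ->
  exists2 L : nat, L%:R = B%:R - x &
  \sum_(i < B.*2.+1) (x < i%:R - B%:R)%R%:R * (i%:R - B%:R - x) ^+ n =
  \sum_(1 <= l < L.+1) l%:R ^+ n.
Proof.
move=> xint xB; have [p pB xE] := int_subnatP xint xB.
exists (B.*2 - p)%N; first by rewrite natrB// xE -mul2n natrM; ring.
rewrite -(sum_above (fun l => l%:R ^+ n) pB); apply: eq_bigr => i _.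
rewrite xE ltrD2r ltr_nat; case: ltnP => // pi; last by rewrite !mul0r.
by rewrite natrB ?(ltnW pi)//; congr (_ * _ ^+ _); ring.
Qed.

Lemma count_above_int (B : nat) (x : R) : x \is a Num.int -> `|x| <= B%:R ->
  \sum_(i < B.*2.+1) (x < i%:R - B%:R)%R%:R = B%:R - x.
Proof.
move=> xint xB; have [L <-] := sum_above_int 0 xint xB.
under eq_bigr do rewrite expr0 mulr1; move=> ->.
by under eq_bigr do rewrite expr0; rewrite sumr_const_nat subn1.
Qed.

Lemma half_int_le (n x : R) : n \is a Num.int -> x \is a Num.int ->
  (n - 2^-1 <= x) = (n <= x) /\ (x <= n - 2^-1) = (x < n).
Proof.
move=> /intrP[p ->] /intrP[q ->]; split.
  rewrite ler_int; apply/idP/idP => [h|]; last by rewrite -(ler_int R); lra.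
  rewrite -ltzD1 -(ltr_int R) rmorphD /=; lra.
rewrite ltr_int; apply/idP/idP => [h|]; first by rewrite -(ltr_int R); lra.
by rewrite -lezD1 -(ler_int R) rmorphD /=; lra.
Qed.

Lemma count_half_itv (B : nat) (l u : R) : l \is a Num.int -> u \is a Num.int ->
  l <= u -> `|l| <= B%:R -> `|u| <= B%:R ->
  \sum_(i < B.*2.+1) (l <= i%:R - B%:R - 2^-1 <= u)%R%:R = u - l.
Proof.
move=> lint uint lu lB uB.
transitivity (\sum_(i < B.*2.+1) ((l < i%:R - B%:R)%R%:R - (u < i%:R - B%:R)%R%:R) : R).
  apply: eq_bigr => i _.
  rewrite (half_int_le (int_subnat _ i B) lint).2 (half_int_le (int_subnat _ i B) uint).1.
  rewrite [(_ <= u)]leNgt; case: (ltP l) => li; case: (ltP u) => ui /=; rewrite ?subrr ?subr0//.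
  by have : False by lra.
by rewrite sumrB !count_above_int//; ring.
Qed.

(** When [i] is paired with [i - 2^-1], membership differs only at [i = l]: this is the one point by
    which a fiber exceeds its shifted count. *)
Lemma count_int_itv (B : nat) (l u : R) : l \is a Num.int -> u \is a Num.int ->
  l <= u -> `|l| <= B%:R -> `|u| <= B%:R ->
  \sum_(i < B.*2.+1) (l <= i%:R - B%:R <= u)%R%:R = u - l + 1.
Proof.
move=> lint uint lu lB uB; rewrite -(count_half_itv lint uint lu lB uB).
have [p pB lE] := int_subnatP lint lB.
have pB' : (p < B.*2.+1)%N by rewrite ltnS.
rewrite (bigD1 (Ordinal pB')) ?inE//= -lE lexx lu/= [in RHS](bigD1 (Ordinal pB')) ?inE//=.
rewrite (half_int_le (int_subnat _ p B) lint).2 lE ltxx/= add0r addrC -lE; congr (_ + _).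
apply: eq_bigr => i ip.
rewrite (half_int_le (int_subnat _ i B) lint).2 (half_int_le (int_subnat _ i B) uint).1.
rewrite le_eqVlt lE (inj_eq (addIr _)) eqr_nat; case: eqP => // pi.
by rewrite -val_eqE /= pi eqxx in ip.
Qed.

End Counting1D.

Section SimplexCount.
Variables (R : realType) (I : finType).
Implicit Types (S U : {set I}) (v : I -> nat -> R) (z y : nat -> R) (d : nat).

(** A shifted lattice point lies on no facet span, so its barycentric coordinates are nonzero and
    [flipped_cone_sum] applies. The same fact reconciles the closed cones of [edge_slice] with the
    open ones of [in_flipped_cone]. *)
Lemma slice_hull_ind d S v t y : #|S| = d.+3 -> indep d.+2 S v ->
  lattice_general d.+2 S v -> t \is a Num.int -> shifted_lattice 2^-1 d.+1 y ->
  hull_ind d.+2 S v (scons t y) =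
  \sum_(a in S | v a 0%N < t)
     flip_sign S (v^~ 0%N) a * hull_ind d.+1 (S :\ a) (edge_slice v a t) y.
Proof.
move=> Sd ind gen tint yint.
have vinj := lattice_general_inj gen.
have zint : shifted_lattice 2^-1 d.+2 (scons t y).
  by apply: shifted_lattice_scons => //; rewrite addr0.
have [[lam lamz]|nolam] := pselect (exists lam, is_affine_comb d.+2 S v (scons t y) lam).
  have lamN0 i : i \in S -> lam i != 0.
    move=> iS; apply/negP => /eqP lami.
    apply: (half_lattice_not_in_span (U := S :\ i) (lam := lam) gen _ _ zint).
    - exact: finset.subD1set.
    - by move: Sd; rewrite (cardsD1 i) iS add1n => -[->].
    - case: lamz => lamS lam1 lamz; split=> // j; rewrite !inE negb_and negbK.
      by move=> /orP[/eqP ->|/lamS].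
  have lamt : \sum_(i in S) lam i * v i 0%N = t.
    case: lamz => lamS lam1 lamz; rewrite -[RHS]/(scons t y 0%N) -lamz// (sum_supp (S := S))// => i /lamS ->.
    by rewrite mul0r.
  have lam1 : \sum_(i in S) lam i = 1 by case: lamz => lamS <- _; rewrite (sum_supp lamS).
  rewrite /hull_ind; transitivity ([forall w in S, 0 < lam w]%:R : R).
    congr (_%:R); congr nat_of_bool; apply/asboolP/forall_inP.
      move=> [mu [mu0 muS mu1 muz]] i iS.
      have mulam : mu =1 lam by apply: affine_comb_unique ind _ lamz.
      by rewrite -mulam lt_neqAle mu0 andbT eq_sym mulam lamN0.
    move=> lamp; case: lamz => lamS lamS1 lamz; exists lam; split=> // i.
    by have [/lamp/ltW|/lamS ->] := boolP (i \in S).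
  rewrite -(@flipped_cone_sum _ _ S (v^~ 0%N) lam t) ?Sd//.
  apply: eq_bigr => a /andP[aS at_]; congr (_ * _%:R); congr nat_of_bool.
  apply/idP/asboolP => [/forall_inP cone|].
    apply: (edge_slice_of_affine vinj aS at_ lamz) => i iS.
    by rewrite ltW// cone.
  case=> mu /(affine_of_edge_slice vinj aS at_)[lam' lamz' h].
  apply/forall_inP => i iS; rewrite (affine_comb_unique ind lamz lamz').
  rewrite lt_neqAle eq_sym h// andbT mulf_neq0//.
    by rewrite -(affine_comb_unique ind lamz lamz') lamN0//; move: iS; rewrite !inE => /andP[].
  move: iS; rewrite !inE => /andP[ia iS]; rewrite subr_eq0.
  by apply: contra ia => /eqP/vinj ->.
rewrite /hull_ind asboolF; last first.
  by case=> lam [lam0 lamS lam1 lamz]; apply: nolam; exists lam.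
rewrite big1// => a /andP[aS at_]; rewrite asboolF ?mulr0//.
by case=> mu /(affine_of_edge_slice vinj aS at_)[lam' lamz' _]; apply: nolam; exists lam'.
Qed.

Definition affine_image_of d S v v' (m : nat) := exists c : nat -> R,
  forall i k, i \in S -> (k < d)%N -> v' i k = c k + m%:R * v i k.

(** A translation is allowed because the slices of a cone are dilates about its apex; for [m = 1]
    this is translation invariance. *)
Definition simplex_scaling_at d := forall S v v' m, (0 < m)%N -> #|S| = d.+1 ->
  indep d S v -> lattice_general d S v -> lattice_general d S v' ->
  affine_image_of d S v v' m -> half_count d S v' = m%:R ^+ d * half_count d S v.


Lemma lattice_general_int0 d S v a : lattice_general d.+1 S v -> a \in S ->
  v a 0%N \is a Num.int.
Proof.
move=> gen aS.
have [||_ [c0 [c [c0int _ cU]]]] := gen 0%N [set a] isT.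
- by rewrite finset.sub1set.
- by rewrite cards1.
- by rewrite (cU a) ?finset.set11// big_ord0 addr0.
Qed.

Lemma indep_sub d S U v : U \subset S -> indep d S v -> indep d U v.
Proof.
move=> /fintype.subsetP US ind eta etaU; apply: ind => i iS; apply: etaU.
by apply: contra iS => /US.
Qed.

(** The coefficient [e_a] of the overview: the signed count of the slice one unit above the apex. *)
Definition cone_count d S v a : R := flip_sign S (v^~ 0%N) a *
  half_count d (S :\ a) (edge_slice v a (v a 0%N + 1)).

Section Step.
Variables (d : nat) (S : {set I}) (v : I -> nat -> R).
Hypotheses (IH : simplex_scaling_at d.+1) (Sd : #|S| = d.+3).
Hypotheses (ind : indep d.+2 S v) (gen : lattice_general d.+2 S v).

Let vinj := lattice_general_inj gen.

Lemma edge_slice_count a t : t \is a Num.int -> a \in S -> v a 0%N < t ->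
  half_count d.+1 (S :\ a) (edge_slice v a t) =
  (t - v a 0%N) ^+ d.+1 * half_count d.+1 (S :\ a) (edge_slice v a (v a 0%N + 1)).
Proof.
move=> tint aS at_; have aint := lattice_general_int0 gen aS.
have /natrP[m mE] : t - v a 0%N \is a Num.nat by rewrite natrEint rpredB//= subr_ge0 ltW.
have m0 : (0 < m)%N by rewrite -(ltr_nat R) -mE subr_gt0.
have a1 : v a 0%N < v a 0%N + 1 by rewrite ltrDl.
rewrite mE; apply: IH => //.
- by move: Sd; rewrite (cardsD1 a) aS add1n => -[->].
- apply: (indep_edge_slice vinj aS a1) => //.
  by rewrite finset.setD1K.
- by apply: (lattice_general_edge_slice vinj aS a1) => //; rewrite rpredD ?rpred1.
- exact: (lattice_general_edge_slice vinj aS at_).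
- exists (fun k => (1 - m%:R) * v a k.+1) => i k _ _.
  rewrite /edge_slice mE -mE; ring.
Qed.

Lemma slice_sum t B : t \is a Num.int ->
  (forall a, (coord_bound d.+1 (edge_slice v a t) <= B)%N) ->
  lattice_sum 2^-1 B d.+1 (fun y => hull_ind d.+2 S v (scons t y)) =
  \sum_(a in S) cone_count d.+1 S v a * ((v a 0%N < t)%R%:R * (t - v a 0%N) ^+ d.+1).
Proof.
move=> tint tB.
under eq_lattice_sum => y yint do rewrite slice_hull_ind//.
rewrite lattice_sum_lin big_mkcondr; apply: eq_bigr => a aS.
case: ifP => at_; last by rewrite mul0r mulr0.
by rewrite (half_countE _ (tB a)) edge_slice_count// /cone_count mul1r; ring.
Qed.

(** For [t] beyond all vertices the slice of the simplex is empty while every apex lies below it, so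
    the signed sum over all of [S] vanishes at every large integer. *)
Lemma cone_count_moment j : (j <= d.+1)%N ->
  \sum_(a in S) cone_count d.+1 S v a * v a 0%N ^+ j = 0.
Proof.
apply: (@moments_eq0 _ _ _ _ _ _ (coord_bound d.+2 v)) => t tB.
pose B := (\sum_a coord_bound d.+1 (edge_slice v a t%:R))%N.
have BE a : (coord_bound d.+1 (edge_slice v a t%:R) <= B)%N by rewrite /B (bigD1 a)//= leq_addr.
have := slice_sum (natr_int _ t) BE.
rewrite lattice_sum0 => [E|y _]; last first.
  rewrite /hull_ind asboolF// => h.
  have := hull_bound h (k := 0) isT (fun i _ => coord_boundP v i (isT : (0 < d.+2)%N)).
  by rewrite /= ger0_norm// ltr_nat ltnNge tB.
rewrite [RHS]E; apply: eq_bigr => a aS; rewrite (_ : v a 0%N < _) ?mul1r//.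
apply: (le_lt_trans (ler_norm _)); apply: (lt_le_trans (coord_boundP _ _ (isT : (0 < d.+2)%N))).
by rewrite ler_nat.
Qed.

Lemma simplex_formula : half_count d.+2 S v = (-1) ^+ d.+2 *
  (\sum_(a in S) cone_count d.+1 S v a * v a 0%N ^+ d.+2) / d.+2%:R.
Proof.
pose A := coord_bound d.+2 v.
pose t_ (i : 'I_A.*2.+1) : R := i%:R - A%:R.
(* [A] bounds the levels; [B] must also contain the slices of the flipped cones, which may leave the
   simplex. *)
pose B := (A + \sum_i \sum_a coord_bound d.+1 (edge_slice v a (t_ i)))%N.
have BE i a : (coord_bound d.+1 (edge_slice v a (t_ i)) <= B)%N.
  by rewrite /B (bigD1 i)//= (bigD1 a)//= addnCA -addnA leq_addr.
have AB : (A <= B)%N by rewrite leq_addr.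
rewrite -(half_countE _ AB) /=.
pose F t := lattice_sum 2^-1 B d.+1 (fun y => hull_ind d.+2 S v (scons t y)).
rewrite (@shrink_sum _ 0 A B F) ?lexx ?ler01//; last first.
  move=> t At; apply: lattice_sum0 => y _; rewrite /hull_ind asboolF// => h.
  have := hull_bound h (k := 0) isT (fun i _ => coord_boundP v i (isT : (0 < d.+2)%N)).
  by rewrite ltNge At.
have FE (i : 'I_A.*2.+1) : F (i%:R - A%:R - 0) = \sum_(a in S) cone_count d.+1 S v a *
    ((v a 0%N < i%:R - A%:R)%R%:R * (i%:R - A%:R - v a 0%N) ^+ d.+1).
  by rewrite subr0 [LHS]slice_sum ?int_subnat// => a; apply: BE.
rewrite (eq_bigr _ (fun i _ => FE i)).
rewrite exchange_big /=.
(* [L] counts the levels of the box strictly above the apex [a], all measured from the common top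
   [X = A] that [weighted_power_sum] asks for. *)
have L_ a : exists L : nat, a \in S -> L%:R = A%:R - v a 0%N /\
    \sum_(i < A.*2.+1) (v a 0%N < i%:R - A%:R)%R%:R * (i%:R - A%:R - v a 0%N) ^+ d.+1 =
    \sum_(1 <= l < L.+1) l%:R ^+ d.+1.
  have [aS|] := boolP (a \in S); last by exists 0%N.
  have aA : `|v a 0%N| <= A%:R by rewrite ltW// coord_boundP.
  have [L LE H] := sum_above_int d.+1 (lattice_general_int0 gen aS) aA.
  by exists L.
have [L LE] := choice L_.
under eq_bigr => a aS do rewrite -mulr_sumr (LE a aS).2.
apply: (weighted_power_sum (X := A%:R)); first exact: cone_count_moment.
by move=> a aS; rewrite (LE a aS).1.
Qed.

End Step.

Lemma flip_sign_scale S (f g : I -> R) (m : nat) a : (0 < m)%N -> a \in S ->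
  (forall i j, i \in S -> j \in S -> f i - f j = m%:R * (g i - g j)) ->
  flip_sign S f a = flip_sign S g a.
Proof.
move=> m0 aS fg; apply: eq_bigr => i; rewrite !inE => /andP[_ iS].
by rewrite fg// sgrM gtr0_sg ?ltr0n// mul1r.
Qed.

(** In dimension one the count is a length. In the step, slices one unit above corresponding apexes
    are translates of each other, so the [e_a] agree; the only surviving moment, of order [d.+2],
    scales, and [shifted_moment] absorbs the translation. *)
Lemma simplex_scaling d : simplex_scaling_at d.+1.
Proof.
elim: d => [|d IH] S v v' m m0 Sd ind gen gen' [c vE].
  have /card_gt0P[x xS] : (0 < #|S|)%N by rewrite Sd.
  have [p pS pmin] := exists_argmin (v^~ 0%N) xS.
  have [q qS qmax] := exists_argmax (v^~ 0%N) xS.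
  have count (u : I -> nat -> R) : lattice_general 1 S u -> u p 0%N <= u q 0%N ->
     (forall i, i \in S -> u p 0%N <= u i 0%N <= u q 0%N) ->
     half_count 1 S u = u q 0%N - u p 0%N.
    move=> ugen upq ub; rewrite /half_count /=; set B := coord_bound _ _.
    have uB i : `|u i 0%N| <= B%:R by rewrite ltW// coord_boundP.
    rewrite -(count_half_itv (lattice_general_int0 ugen pS) (lattice_general_int0 ugen qS) upq (uB p) (uB q)).
    apply: eq_bigr => i _; congr (_%:R); congr nat_of_bool; apply/asboolP/idP.
      case=> lam [lam0 lamS lam1 /(_ 0%N isT) /= <-]; apply/andP; split.
        rewrite -[u p _]mul1r -lam1 mulr_suml; apply: ler_sum => j _.
        have [jS|/lamS ->] := boolP (j \in S); last by rewrite !mul0r.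
        by rewrite ler_wpM2l//; have /andP[] := ub j jS.
      rewrite -[u q _]mul1r -lam1 mulr_suml; apply: ler_sum => j _.
      have [jS|/lamS ->] := boolP (j \in S); last by rewrite !mul0r.
      by rewrite ler_wpM2l//; have /andP[] := ub j jS.
    set z := (_ - _ - _) => /andP[pz zq].
    pose w := if u q 0%N == u p 0%N then 0 else (z - u p 0%N) / (u q 0%N - u p 0%N).
    have [w0 w1 wz] : [/\ 0 <= w, w <= 1 & (1 - w) * u p 0%N + w * u q 0%N = z].
      rewrite /w; case: eqP => [E|/eqP N]; first by split=> //; lra.
      have N' : 0 < u q 0%N - u p 0%N by rewrite subr_gt0 lt_neqAle eq_sym N.
      split; first by rewrite divr_ge0 ?subr_ge0// ltW.
        by rewrite ler_pdivrMr//; lra.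
      by field; rewrite gt_eqF.
    have sumE f : \sum_i ((1 - w) * (i == p)%:R + w * (i == q)%:R) * f i =
        (1 - w) * f p + w * f q.
      under eq_bigr do rewrite mulrDl.
      rewrite big_split /= (bigD1 p)//= eqxx big1 ?addr0 => [|j /negPf ->]; last by rewrite mulr0 mul0r.
      rewrite (bigD1 q)//= eqxx big1 ?addr0 => [|j /negPf ->]; last by rewrite mulr0 mul0r.
      by rewrite !mulr1.
    exists (fun i => (1 - w) * (i == p)%:R + w * (i == q)%:R); split.
    - by move=> j; rewrite addr_ge0 ?mulr_ge0 ?subr_ge0.
    - move=> j jS; have [jp|_] := eqVneq j p; first by rewrite jp pS in jS.
      have [jq|_] := eqVneq j q; first by rewrite jq qS in jS.
      by rewrite !mulr0 addr0.
    - by have := sumE (fun=> 1); under eq_bigr do rewrite mulr1; move=> ->; ring.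
    - by case=> // _; rewrite sumE wz.
  have m0' : 0 <= m%:R :> R by rewrite ler0n.
  rewrite !count//.
  - by rewrite !vE//; ring.
  - by rewrite pmin.
  - by move=> i iS; rewrite pmin ?qmax.
  - by rewrite !vE// lerD2l ler_wpM2l// pmin.
  - by move=> i iS; rewrite !vE// !lerD2l !ler_wpM2l ?pmin ?qmax.
have c0int : c 0%N \is a Num.int.
  have /card_gt0P[x xS] : (0 < #|S|)%N by rewrite Sd.
  have := lattice_general_int0 gen' xS; rewrite vE// => h.
  rewrite -[c 0%N](addrK (m%:R * v x 0%N)) rpredB// rpredM ?natr_int//.
  exact: lattice_general_int0 gen xS.
have ind' : indep d.+2 S v'.
  move=> eta etaS eta1 etak; apply: ind => // k kd.
  have m0' : m%:R != 0 :> R by rewrite pnatr_eq0 -lt0n.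
  apply: (mulfI m0'); rewrite mulr0 -[RHS](etak k kd) mulr_sumr.
  rewrite -[LHS]add0r -{1}(mul0r (c k)) -{1}eta1 mulr_suml -big_split /=.
  apply: eq_bigr => i _; have [iS|/etaS ->] := boolP (i \in S); last by rewrite !mul0r mulr0 addr0.
  by rewrite vE//; ring.
have diff i j k : i \in S -> j \in S -> (k < d.+2)%N ->
    v' i k - v' j k = m%:R * (v i k - v j k) by move=> iS jS kd; rewrite !vE//; ring.
have coneE a : a \in S -> cone_count d.+1 S v' a = cone_count d.+1 S v a.
  move=> aS; rewrite /cone_count (@flip_sign_scale S _ (v^~ 0%N) m)//; last first.
    by move=> i j iS jS; rewrite diff.
  have a1 : v a 0%N < v a 0%N + 1 by rewrite ltrDl.
  have a1' : v' a 0%N < v' a 0%N + 1 by rewrite ltrDl.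
  congr (_ * _).
  rewrite (IH _ (edge_slice v a (v a 0%N + 1)) _ 1%N) ?expr1n ?mul1r//.
  - by move: Sd; rewrite (cardsD1 a) aS add1n => -[->].
  - apply: (indep_edge_slice (lattice_general_inj gen) aS a1) => //.
    by rewrite finset.setD1K.
  - apply: (lattice_general_edge_slice (lattice_general_inj gen) aS a1) => //.
    by rewrite rpredD ?rpred1// (lattice_general_int0 gen).
  - apply: (lattice_general_edge_slice (lattice_general_inj gen') aS a1') => //.
    by rewrite rpredD ?rpred1// (lattice_general_int0 gen').
  exists (fun k => v' a k.+1 - v a k.+1) => i k; rewrite !inE => /andP[ia iS] kd.
  rewrite /edge_slice !diff// mul1r.
  have vN : v i 0%N - v a 0%N != 0.
    by rewrite subr_eq0; apply: contra ia => /eqP/(lattice_general_inj gen) ->.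
  field; rewrite vN/= pnatr_eq0; lia.
rewrite (simplex_formula IH Sd ind gen) (simplex_formula IH Sd ind' gen').
rewrite mulrA; congr (_ / _).
have mom := cone_count_moment IH Sd ind gen.
under eq_bigr => a aS do rewrite coneE// vE//.
(* Since [c 0 + m a = - m (- c 0 / m - a)], the new top moment is the old one shifted to
   [X = - c 0 / m]. *)
transitivity (m%:R ^+ d.+2 *
  \sum_(a in S) cone_count d.+1 S v a * (- c 0%N / m%:R - v a 0%N) ^+ d.+2); last first.
  by congr (_ * _); exact: shifted_moment mom.
rewrite !mulr_sumr; apply: eq_bigr => a _.
rewrite mulrCA [RHS]mulrCA; congr (_ * _).
rewrite -!exprMn; congr (_ ^+ _); field; rewrite pnatr_eq0; lia.
Qed.
End SimplexCount.

(** * Basic solutions and regular triangulations *)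

Section BasicSolutions.
Variables (R : realType) (I : finType).
Implicit Types (S U : {set I}) (v : I -> nat -> R) (z y : nat -> R) (d : nat).
Implicit Types (lam eta w : I -> R).

Definition supp lam : {set I} := [set i | lam i != 0].

Lemma suppPn lam i : i \notin supp lam -> lam i = 0.
Proof. by rewrite inE negbK => /eqP. Qed.

Definition is_dependency d v eta :=
  \sum_i eta i = 0 /\ forall k, (k < d)%N -> \sum_i eta i * v i k = 0.

Lemma indepE d U v : indep d U v <-> forall eta, is_dependency d v eta ->
  (forall i, i \notin U -> eta i = 0) -> forall i, eta i = 0.
Proof. by split=> [h eta [? ?] ?|h eta ? ? ?]; apply: h. Qed.

Lemma indep_card d U v : indep d U v -> (#|U| <= d.+1)%N.
Proof.
move=> ind; rewrite leqNgt; apply/negP => dU.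
pose A := \matrix_(i < #|U|, j < d.+1) (if j is Ordinal j'.+1 _ then v (enum_val i) j' else 1) : 'M[R]_(_, _).
have : kermx A != 0.
  rewrite -mxrank_eq0 mxrank_ker subn_eq0 -ltnNge.
  by rewrite (leq_ltn_trans (rank_leq_col _)).
case/rowV0Pn => u /sub_kermxP uA u0.
pose eta i := \sum_j u 0 j * (enum_val j == i)%:R.
have etaE f : \sum_i eta i * f i = \sum_j u 0 j * f (enum_val j).
  under eq_bigr do rewrite mulr_suml.
  rewrite exchange_big /=; apply: eq_bigr => j _.
  rewrite (bigD1 (enum_val j))//= eqxx mulr1 big1 ?addr0// => i /negPf ij.
  by rewrite eq_sym ij mulr0 mul0r.
have eta0 i : eta i = 0.
  apply: (ind eta) => [{}i iU||k kd].
  - rewrite /eta big1// => j _; case: eqP => [ji|]; last by rewrite mulr0.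
    by rewrite -ji enum_valP in iU.
  - have := congr1 (fun M : 'rV_d.+1 => M 0 ord0) uA; rewrite !mxE.
    under eq_bigr do rewrite !mxE.
    move=> /= h; rewrite -[RHS]h -(etaE (fun=> 1)).
    by apply: eq_bigr => j _; rewrite mulr1.
  - have := congr1 (fun M : 'rV_d.+1 => M 0 (lift ord0 (Ordinal kd))) uA; rewrite !mxE.
    by under eq_bigr do rewrite !mxE; move=> /= h; rewrite -[RHS]h (etaE (v^~ k)).
move/eqP: u0; apply; apply/rowP => j; rewrite mxE.
rewrite -(eta0 (enum_val j)) /eta (bigD1 j)//= eqxx mulr1 big1 ?addr0// => l lj.
by rewrite (inj_eq enum_val_inj) (negPf lj) mulr0.
Qed.

Lemma weight_move d S v z lam eta theta : is_weight d S v z lam ->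
  is_dependency d v eta -> (forall i, i \notin S -> eta i = 0) ->
  (forall i, 0 <= lam i + theta * eta i) ->
  is_weight d S v z (fun i => lam i + theta * eta i).
Proof.
move=> [lam0 lamS lam1 lamz] [eta1 etaz] etaS le0; split=> //.
- by move=> i iS; rewrite lamS// etaS// mulr0 addr0.
- by rewrite big_split /= -mulr_sumr eta1 mulr0 addr0.
move=> k kd; under eq_bigr do rewrite mulrDl -mulrA.
by rewrite big_split /= -mulr_sumr etaz// mulr0 addr0 lamz.
Qed.

(* One pivot of the simplex method: move along a cost-nonincreasing dependency
   until a weight vanishes. *)
Lemma weight_pivot d S v z lam w : is_weight d S v z lam -> ~ indep d (supp lam) v ->
  exists lam', [/\ is_weight d S v z lam', (#|supp lam'| < #|supp lam|)%N &
    \sum_i lam' i * w i <= \sum_i lam i * w i].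
Proof.
move=> lamw nind.
have [eta [dep etaS [x etax]]] : exists eta, [/\ is_dependency d v eta,
    forall i, i \notin supp lam -> eta i = 0 & exists i, eta i != 0].
  apply: contrapT => h; apply: nind; apply/indepE => eta dep etaS i.
  by apply/eqP/negPn/negP => ei; apply: h; exists eta; split=> //; exists i.
wlog cost : eta dep etaS x etax / \sum_i eta i * w i <= 0.
  move=> h; case: (leP (\sum_i eta i * w i) 0) => [|c0]; first exact: (h eta dep etaS x).
  apply: (h (fun i => - eta i) _ _ x).
  - case: dep => e1 e2; split; first by rewrite sumrN e1 oppr0.
    by move=> k kd; under eq_bigr do rewrite mulNr; rewrite sumrN e2// oppr0.
  - by move=> i /etaS ->; rewrite oppr0.
  - by rewrite oppr_eq0.
  - by under eq_bigr do rewrite mulNr; rewrite sumrN oppr_le0 ltW.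
have [j jneg] : exists j, eta j < 0.
  apply: contrapT => h; have pos i : 0 <= eta i by rewrite leNgt; apply/negP => hi; apply: h; exists i.
  have : \sum_i eta i == 0 by case: dep => ->.
  by rewrite psumr_eq0// => /allP/(_ x (mem_index_enum _)); rewrite (negPf etax).
(* The ratio test: among the decreasing weights [p] reaches zero first, so [theta] is the longest
   step that keeps all weights nonnegative. *)
have [|p] := @exists_argmin _ _ [set i | eta i < 0] (fun i => lam i / - eta i) j.
  by rewrite inE.
rewrite inE => pneg pmin.
have [lam0 lamS _ _] := lamw.
pose theta := lam p / - eta p.
have theta0 : 0 <= theta by rewrite divr_ge0// oppr_ge0 ltW.
have nonneg i : 0 <= lam i + theta * eta i.
  have [i0|i0] := leP 0 (eta i); first by rewrite addr_ge0// mulr_ge0.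
  have := pmin i; rewrite inE => /(_ i0); rewrite -/theta.
  by rewrite ler_pdivlMr ?oppr_gt0// mulrN => h; lra.
exists (fun i => lam i + theta * eta i); split.
- apply: weight_move => // i iS; apply: etaS; rewrite inE negbK; exact/eqP/lamS.
- apply: proper_card; apply/properP; split.
    apply/fintype.subsetP => i; apply: contraLR => iS; rewrite inE negbK.
    by rewrite (suppPn iS) etaS// mulr0 addr0.
  exists p; last first.
    by rewrite inE negbK /theta; apply/eqP; field; rewrite lt_eqF.
  by apply: contraLR pneg => /etaS ->; rewrite ltxx.
- under eq_bigr do rewrite mulrDl -mulrA.
  by rewrite big_split /= -mulr_sumr gerDl mulr_ge0_le0.
Qed.

Lemma basic_weight d S v z lam w : is_weight d S v z lam ->
  exists lam', [/\ is_weight d S v z lam', indep d (supp lam') v &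
    \sum_i lam' i * w i <= \sum_i lam i * w i].
Proof.
have [n] := ubnP #|supp lam|; elim: n lam => // n IH lam; rewrite ltnS => lamn lamw.
have [ind|nind] := pselect (indep d (supp lam) v); first by exists lam.
have [lam' [lamw' lt_supp le_cost]] := weight_pivot w lamw nind.
have [|lam'' [? ? le_cost']] := IH lam' _ lamw'; first exact: leq_trans lamn.
by exists lam''; split=> //; exact: le_trans le_cost.
Qed.

Lemma weight_unique d S v z lam lam' U : indep d U v ->
  is_weight d S v z lam -> is_weight d S v z lam' ->
  supp lam \subset U -> supp lam' \subset U -> lam =1 lam'.
Proof.
move=> ind [_ _ l1 lz] [_ _ l1' lz'] /fintype.subsetP lU /fintype.subsetP lU'.
apply: (affine_comb_unique (z := z) ind).
- by split=> // i iU; apply: suppPn; apply: contra iU => /lU.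
- by split=> // i iU; apply: suppPn; apply: contra iU => /lU'.
Qed.

(** Basic weights do at least as well as arbitrary ones, and an independent support determines its
    weight, so the minimum is taken over finitely many supports. *)
Lemma optimal_weight d S v z w : inhull d S v z ->
  exists lam, [/\ is_weight d S v z lam, indep d (supp lam) v &
    forall mu, is_weight d S v z mu -> \sum_i lam i * w i <= \sum_i mu i * w i].
Proof.
move=> [lam0 lam0w].
pose P (U : {set I}) lam := [/\ is_weight d S v z lam, supp lam = U & indep d U v].
have F_ U : exists lam, (exists mu, P U mu) -> P U lam.
  by have [[mu Pmu]|nP] := pselect (exists mu, P U mu); [exists mu|exists lam0].
have [F FE] := choice F_.
have [lam1 [lam1w lam1i _]] := basic_weight w lam0w.
have [|U] := @exists_argmin _ _ [set U : {set I} | `[< exists mu, P U mu >]]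
  (fun U => \sum_i F U i * w i) (supp lam1).
  by rewrite inE; apply/asboolP; exists lam1.
rewrite inE => /asboolP/FE[FUw FUs FUi] Umin; exists (F U); split=> //.
  by rewrite FUs.
move=> mu /(basic_weight w)[mu' [mu'w mu'i]]; apply: le_trans.
have [|Fw Fs Fi] := FE (supp mu'); first by exists mu'.
have <- : \sum_i F (supp mu') i * w i = \sum_i mu' i * w i.
  apply: eq_bigr => i _; congr (_ * _).
  by apply: (weight_unique mu'i Fw mu'w); rewrite ?Fs.
by apply: Umin; rewrite inE; apply/asboolP; exists mu'.
Qed.

End BasicSolutions.

Section Triangulation.
Variables (R : realType) (I : finType).
Implicit Types (S U : {set I}) (v : I -> nat -> R) (z y : nat -> R) (d : nat).
Implicit Types (lam eta w : I -> R).

Lemma poly_nonroot (p : {poly R}) : p != 0 -> exists b, p.[b] != 0.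
Proof.
move=> pN0; apply: contrapT => h; move/eqP: pN0; apply.
apply: (poly_eq0_nat (T := 0)) => t _; apply/eqP/negPn/negP => pt.
by apply: h; exists t%:R.
Qed.

(** The dependencies considered are the affine circuits, unique up to a factor; a generic cost
    vanishes on none of them. *)
Definition generic_cost d v w := forall U i eta, i \notin U -> indep d U v ->
  is_dependency d v eta -> (forall j, j \notin i |: U -> eta j = 0) ->
  eta i != 0 -> \sum_j eta j * w j != 0.

Lemma is_dependencyB d v eta eta' c : is_dependency d v eta -> is_dependency d v eta' ->
  is_dependency d v (fun i => eta i - c * eta' i).
Proof.
move=> [e1 e2] [e1' e2']; split; first by rewrite sumrB -mulr_sumr e1 e1' mulr0 subrr.
move=> k kd; under eq_bigr do rewrite mulrBl -mulrA.
by rewrite sumrB -mulr_sumr e2// e2'// mulr0 subrr.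
Qed.

Lemma dependency_prop d U v i eta eta' : i \notin U -> indep d U v ->
  is_dependency d v eta -> is_dependency d v eta' ->
  (forall j, j \notin i |: U -> eta j = 0) -> (forall j, j \notin i |: U -> eta' j = 0) ->
  eta' i = 1 -> forall j, eta j = eta i * eta' j.
Proof.
move=> iU /indepE ind dep dep' etaS etaS' etai j; apply/eqP; rewrite -subr_eq0; apply/eqP.
apply: (ind _ (is_dependencyB (eta i) dep dep')) => {}j jU.
have [->|ji] := eqVneq j i; first by rewrite etai mulr1 subrr.
have jS : j \notin i |: U by rewrite !inE negb_or ji.
by rewrite etaS// etaS'// mulr0 subrr.
Qed.

(* The costs [b ^ rank i] are generic for all but finitely many [b], since the
   cost of a nonzero dependency is a nonzero polynomial in [b]. *)
Lemma exists_generic_cost d v : exists w, generic_cost d v w.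
Proof.
pose P (Ui : {set I} * I) eta := [/\ is_dependency d v eta,
  forall j, j \notin Ui.2 |: Ui.1 -> eta j = 0 & eta Ui.2 = 1].
(* Pairs without a circuit get the constant [1], so that the coefficient at [Ui.2] is always [1] and
   every factor [q Ui] is a nonzero polynomial. *)
have E_ Ui : exists eta, eta Ui.2 = 1 /\ ((exists mu, P Ui mu) -> P Ui eta).
  have [[mu Pmu]|nP] := pselect (exists mu, P Ui mu).
    by exists mu; split=> //; case: Pmu.
  by exists (fun=> 1).
have [E EP] := choice E_.
pose q Ui := \sum_j (E Ui j) *: 'X^(enum_rank j) : {poly R}.
have qN0 : \prod_Ui q Ui != 0.
  apply/prodf_neq0 => Ui _; apply: contraTneq (oner_neq0 R) => q0.
  have := congr1 (fun p : {poly R} => p`_(enum_rank Ui.2)) q0.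
  rewrite coef0 coef_sum (bigD1 Ui.2)//= big1 ?addr0.
    by rewrite coefZ coefXn eqxx mulr1 (EP Ui).1 => ->; rewrite eqxx.
  move=> j jU; rewrite coefZ coefXn val_eqE (inj_eq enum_rank_inj) eq_sym (negPf jU).
  exact: mulr0.
have [b] := poly_nonroot qN0.
rewrite horner_prod => /prodf_neq0 bP.
exists (fun j => b ^+ enum_rank j) => U i eta iU ind dep etaS eta0.
have Pmu : P (U, i) (fun j => eta j / eta i).
  split=> //=; last by rewrite divff.
    case: dep => e1 e2; split; first by rewrite -mulr_suml e1 mul0r.
    by move=> k kd; under eq_bigr do rewrite mulrAC; rewrite -mulr_suml e2// mul0r.
  by move=> j /etaS ->; rewrite mul0r.
have [Edep ES Ei] := (EP (U, i)).2 (ex_intro _ _ Pmu).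
under eq_bigr do rewrite (dependency_prop iU ind dep Edep etaS ES Ei) -mulrA.
rewrite -mulr_sumr mulf_neq0//; have := bP (U, i) isT.
by rewrite /q horner_sum; under eq_bigr do rewrite hornerZ hornerXn.
Qed.

(* The maximal cells of the regular triangulation induced by the heights [w]. *)
Definition cell d v w U := [/\ #|U| = d.+1, indep d U v &
  forall eta, is_dependency d v eta -> (forall i, i \notin U -> 0 <= eta i) ->
    (exists i, eta i != 0) -> 0 < \sum_i eta i * w i].

Lemma dependency_through d U v i : #|U| = d.+1 -> indep d U v -> i \notin U ->
  exists eta, [/\ is_dependency d v eta, forall j, j \notin i |: U -> eta j = 0 & eta i = 1].
Proof.
move=> Ud ind iU.
have : ~ indep d (i |: U) v.
  by move=> /indep_card; rewrite cardsU1 iU Ud ltnn.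
move=> nind; have [eta [dep etaS [x etax]]] : exists eta, [/\ is_dependency d v eta,
    forall j, j \notin i |: U -> eta j = 0 & exists j, eta j != 0].
  apply: contrapT => h; apply: nind; apply/indepE => eta dep etaS j.
  by apply/eqP/negPn/negP => ej; apply: h; exists eta; split=> //; exists j.
have etai : eta i != 0.
  apply: contra_neq etax => etai; move/indepE: ind => /(_ eta dep); apply=> j jU.
  have [->//|ji] := eqVneq j i; by rewrite etaS// !inE negb_or ji.
exists (fun j => eta j / eta i); split=> /=; last by rewrite divff.
  case: dep => e1 e2; split; first by rewrite -mulr_suml e1 mul0r.
  by move=> k kd; under eq_bigr do rewrite mulrAC; rewrite -mulr_suml e2// mul0r.
by move=> j /etaS ->; rewrite mul0r.
Qed.

(** Subtracting the fundamental circuits through the indices outside [U] leaves a dependency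
    supported on [U], hence zero. So [eta] is a nonnegative combination of these circuits, and it is
    enough that each has positive cost: the reduced-cost criterion of linear programming. *)
Lemma dependency_decomp d U v w eta : #|U| = d.+1 -> indep d U v ->
  is_dependency d v eta ->
  (forall i rho, i \notin U -> is_dependency d v rho ->
     (forall j, j \notin i |: U -> rho j = 0) -> rho i = 1 -> 0 < \sum_j rho j * w j) ->
  (forall i, i \notin U -> 0 <= eta i) -> (exists i, eta i != 0) ->
  0 < \sum_i eta i * w i.
Proof.
move=> Ud ind dep pos eta0 [x etax].
have E_ i : exists rho, i \notin U -> [/\ is_dependency d v rho,
    forall j, j \notin i |: U -> rho j = 0 & rho i = 1].
  have [iU|iU] := boolP (i \in U); first by exists eta.
  by have [rho] := dependency_through Ud ind iU; exists rho.
have [E EP] := choice E_.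
have etaE j : eta j = \sum_(i | i \notin U) eta i * E i j.
  apply/eqP; rewrite -subr_eq0; apply/eqP.
  move/indepE: ind => /(_ (fun j => eta j - \sum_(i | i \notin U) eta i * E i j)); apply.
    case: dep => e1 e2; split.
      rewrite sumrB e1 exchange_big /= big1 ?subrr// => i /EP[[E1 _] _ _].
      by rewrite -mulr_sumr E1 mulr0.
    move=> k kd; under eq_bigr do rewrite mulrBl mulr_suml.
    rewrite sumrB e2// exchange_big /= big1 ?subrr// => i /EP[[_ E2] _ _].
    by under eq_bigr do rewrite -mulrA; rewrite -mulr_sumr E2// mulr0.
  move=> {}j jU; have [_ _ Ejj] := EP j jU.
  rewrite (bigD1 j)//= Ejj mulr1 big1 ?addr0 ?subrr// => i /andP[iU ij].
  by have [_ EiS _] := EP i iU; rewrite EiS ?mulr0// !inE negb_or eq_sym ij jU.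
have [y yU etay] : exists2 y, y \notin U & eta y != 0.
  apply: contrapT => h; case/negP: etax; rewrite etaE big1// => i iU.
  have [->|ei] := eqVneq (eta i) 0; first by rewrite mul0r.
  by case: h; exists i.
have -> : \sum_i eta i * w i = \sum_(i | i \notin U) eta i * \sum_j E i j * w j.
  under eq_bigr do rewrite etaE mulr_suml.
  rewrite exchange_big /=; apply: eq_bigr => i iU.
  by rewrite mulr_sumr; apply: eq_bigr => j _; rewrite mulrA.
have posE i : i \notin U -> 0 < \sum_j E i j * w j.
  by move=> iU; have [e1 e2 e3] := EP i iU; exact: (pos i).
rewrite (bigD1 y)//= ltr_wpDr//.
  by apply: sumr_ge0 => i /andP[iU _]; rewrite mulr_ge0 ?eta0// ltW// posE.
by rewrite mulr_gt0 ?posE// lt_neqAle eq_sym etay eta0.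
Qed.

Lemma cell_cost_lt d v w z U lam mu : cell d v w U ->
  is_weight d finset.setT v z lam -> (forall i, i \notin U -> lam i = 0) ->
  is_weight d finset.setT v z mu -> (exists i, mu i != lam i) ->
  \sum_i lam i * w i < \sum_i mu i * w i.
Proof.
move=> [_ _ pos] [l0 _ l1 lz] lU [m0 _ m1 mz] [x mlx].
rewrite -subr_gt0 -sumrB; under eq_bigr do rewrite -mulrBl.
apply: (pos (fun i => mu i - lam i)).
- split=> [|k kd]; first by rewrite sumrB m1 l1 subrr.
  by under eq_bigr do rewrite mulrBl; rewrite sumrB mz// lz// subrr.
- by move=> i /lU ->; rewrite subr0.
- by exists x; rewrite subr_eq0.
Qed.

(** The support of a cheapest basic weight is the cell. It has full size because the point avoids
    spans of fewer vertices; its reduced costs are nonzero by genericity, and a negative one would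
    lead to a cheaper weight. *)
Lemma cell_of_half_lattice_point d v w z : generic_cost d.+1 v w ->
  lattice_general d.+1 finset.setT v -> shifted_lattice 2^-1 d.+1 z ->
  inhull d.+1 finset.setT v z -> exists2 U, cell d.+1 v w U & inhull d.+1 U v z.
Proof.
move=> gw gen zint /(optimal_weight w)[lam [lamw ind opt]].
have [l0 _ l1 lz] := lamw.
have cU : #|supp lam| = d.+2.
  apply/eqP; rewrite eqn_leq (indep_card ind)/= ltnNge; apply/negP => lt.
  apply: (half_lattice_not_in_span gen (finset.subsetT (supp lam)) lt zint (lam := lam)).
  by split=> // i; apply: suppPn.
exists (supp lam); last by exists lam; split=> // i; apply: suppPn.
split=> // eta dep; apply: (dependency_decomp cU ind dep) => i rho iU rdep rS ri.
have cost0 : \sum_j rho j * w j != 0 by apply: (gw _ _ _ iU ind rdep rS); rewrite ri oner_neq0.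
rewrite lt_neqAle eq_sym cost0 /= leNgt; apply/negP => neg.
have [t t0 tP] : exists2 t : R, 0 < t & forall j, 0 <= lam j + t * rho j.
  have lamp j : j \in supp lam -> 0 < lam j by rewrite inE lt_neqAle eq_sym l0 => ->.
  have /card_gt0P[x xU] : (0 < #|supp lam|)%N by rewrite cU.
  have [p pU pmin] := exists_argmin lam xU.
  (* [M] exceeds every [rho j] in absolute value and [lam p] is the least weight on the support, so
     a step of [lam p / M] keeps all weights nonnegative. *)
  pose M := 1 + \sum_j `|rho j|.
  have M0 : 0 < M by rewrite ltr_wpDr// sumr_ge0.
  exists (lam p / M) => [|j]; first by rewrite divr_gt0// lamp.
  have [jU|jU] := boolP (j \in supp lam); last first.
    rewrite addr_ge0// mulr_ge0//; first by rewrite ltW// divr_gt0// lamp.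
    have [->|ji] := eqVneq j i; first by rewrite ri.
    by rewrite rS// in_setU1 negb_or ji.
  have : `|lam p / M * rho j| <= lam p.
    rewrite normrM gtr0_norm ?divr_gt0 ?lamp// mulrAC ler_pdivrMr// ler_pM2l ?lamp//.
    rewrite /M (bigD1 j)//=.
    have : 0 <= \sum_(k | k != j) `|rho k| by apply: sumr_ge0.
    by lra.
  by rewrite ler_norml => /andP[h _]; have := pmin j jU; lra.
have rT j : j \notin finset.setT -> rho j = 0 by rewrite finset.in_setT.
have := opt _ (weight_move lamw rdep rT tP).
under [leRHS]eq_bigr do rewrite mulrDl -mulrA.
rewrite big_split /= -mulr_sumr; have := mulr_gt0 t0 (_ : 0 < - (\sum_j rho j * w j)).
by rewrite oppr_gt0 mulrN => /(_ neg); lra.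
Qed.

Lemma hull_sub d S U v z : U \subset S -> inhull d U v z -> inhull d S v z.
Proof.
move=> /fintype.subsetP US [lam [l0 lU l1 lz]]; exists lam; split=> // i iS.
by apply: lU; apply: contra iS => /US.
Qed.

(** In either cell the weight of the point is strictly cheaper than any other, so the two weights
    coincide; each is supported on its whole cell because the point lies on no smaller span. *)
Lemma cell_unique d v w z U U' : lattice_general d.+1 finset.setT v ->
  shifted_lattice 2^-1 d.+1 z ->
  cell d.+1 v w U -> cell d.+1 v w U' -> inhull d.+1 U v z -> inhull d.+1 U' v z -> U = U'.
Proof.
move=> gen zint cU cU' [lam lamw] [mu muw].
have toT V rho : is_weight d.+1 V v z rho -> is_weight d.+1 finset.setT v z rho.
  by case=> r0 rV r1 rz; split=> // i; rewrite finset.in_setT.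
have full V rho : cell d.+1 v w V -> is_weight d.+1 V v z rho -> supp rho = V.
  move=> [Vd _ _] [r0 rV r1 rz].
  have sV : supp rho \subset V.
    by apply/fintype.subsetP => i; apply: contraLR => /rV ri; rewrite inE ri eqxx.
  apply/eqP; rewrite eqEcard sV Vd ltnNge; apply/negP => lt.
  apply: (half_lattice_not_in_span gen (finset.subsetT (supp rho)) lt zint (lam := rho)).
  by split=> // i; apply: suppPn.
have E : lam =1 mu.
  move=> i; apply/eqP/negPn/negP => ne.
  have [_ lU _ _] := lamw; have [_ mU _ _] := muw.
  have h1 := cell_cost_lt cU (toT _ _ lamw) lU (toT _ _ muw).
  have h2 := cell_cost_lt cU' (toT _ _ muw) mU (toT _ _ lamw).
  have ne' : mu i != lam i by rewrite eq_sym.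
  by have := lt_trans (h1 (ex_intro _ i ne')) (h2 (ex_intro _ i ne)); rewrite ltxx.
rewrite -(full _ _ cU lamw) -(full _ _ cU' muw); apply/setP => i.
by rewrite !inE E.
Qed.

Definition cells d v w : {set {set I}} := [set U | `[< cell d v w U >]].

Lemma hull_ind_cells d v w z : generic_cost d.+1 v w ->
  lattice_general d.+1 finset.setT v -> shifted_lattice 2^-1 d.+1 z ->
  hull_ind d.+1 finset.setT v z = \sum_(U in cells d.+1 v w) hull_ind d.+1 U v z.
Proof.
move=> gw gen zint; rewrite /hull_ind.
have [zh|zh] := pselect (inhull d.+1 finset.setT v z); last first.
  rewrite asboolF// big1// => U _; rewrite asboolF// => zU; apply: zh.
  exact: hull_sub (finset.subsetT U) zU.
have [U cU zU] := cell_of_half_lattice_point gw gen zint zh.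
have Uc : U \in cells d.+1 v w by rewrite inE; apply/asboolP.
rewrite asboolT// (bigD1 U)//= asboolT// big1 ?addr0// => V /andP[].
rewrite inE => /asboolP cV VU; rewrite asboolF// => zV.
by move/eqP: VU; apply; apply: (cell_unique gen zint cV cU zV zU).
Qed.

Lemma half_count_cells d v w : generic_cost d.+1 v w ->
  lattice_general d.+1 finset.setT v ->
  half_count d.+1 finset.setT v = \sum_(U in cells d.+1 v w) half_count d.+1 U v.
Proof.
move=> gw gen; rewrite /half_count.
under eq_lattice_sum => z zint.
  rewrite (hull_ind_cells gw gen zint).
  under eq_bigr do rewrite -[hull_ind _ _ _ _]mul1r.
  over.
rewrite (@lattice_sum_lin R _ _ _ _ _ _ (fun=> 1) (fun U => hull_ind d.+1 U v)).
by apply: eq_bigr => U _; rewrite mul1r.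
Qed.

Definition scale_family (m : nat) v : I -> nat -> R := fun i k => m%:R * v i k.

Section Scale.
Variables (m : nat) (d : nat) (v : I -> nat -> R).
Hypothesis m0 : (0 < m)%N.
Let mN0 : m%:R != 0 :> R. Proof. by rewrite pnatr_eq0 -lt0n. Qed.

Lemma is_dependency_scale eta :
  is_dependency d (scale_family m v) eta <-> is_dependency d v eta.
Proof.
have E k : \sum_i eta i * scale_family m v i k = m%:R * \sum_i eta i * v i k.
  by rewrite mulr_sumr; apply: eq_bigr => i _; rewrite mulrCA.
split=> -[e1 e2]; split=> // k kd; last by rewrite E e2// mulr0.
by apply: (mulfI mN0); rewrite -E e2// mulr0.
Qed.

Lemma indep_scale U : indep d U (scale_family m v) <-> indep d U v.
Proof.
by split=> /indepE h; apply/indepE => eta dep; apply: h; apply/is_dependency_scale.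
Qed.

Lemma cell_scale w U : cell d (scale_family m v) w U <-> cell d v w U.
Proof.
split=> -[h1 h2 h3]; split=> //.
- exact/indep_scale.
- by move=> eta dep; apply: h3; apply/is_dependency_scale.
- exact/indep_scale.
- by move=> eta dep; apply: h3; apply/is_dependency_scale.
Qed.

Lemma generic_cost_scale w : generic_cost d v w -> generic_cost d (scale_family m v) w.
Proof.
by move=> gw U i eta iU /indep_scale ind /is_dependency_scale dep; apply: (gw U).
Qed.

End Scale.

Lemma lattice_general_scale m d S v : (0 < m)%N -> lattice_general d S v ->
  lattice_general d S (scale_family m v).
Proof.
move=> m0 gen k U kd US Uk; have [ind [c0 [c [c0int cint cU]]]] := gen k U kd US Uk.
split; first exact/indep_scale.
exists (m%:R * c0), c; split=> // [|u uU]; first by rewrite rpredM ?natr_int.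
rewrite /scale_family cU// mulrDr mulr_sumr; congr (_ + _).
by apply: eq_bigr => j _; rewrite mulrCA.
Qed.

(** Dilation preserves affine dependencies, so the same heights cut both hulls into simplices with
    the same index sets. *)
Lemma half_count_scale d v m : (0 < m)%N -> lattice_general d.+1 finset.setT v ->
  half_count d.+1 finset.setT (scale_family m v) =
  m%:R ^+ d.+1 * half_count d.+1 finset.setT v.
Proof.
move=> m0 gen; have [w gw] := exists_generic_cost d.+1 v.
have gen' := lattice_general_scale m0 gen.
rewrite (half_count_cells (generic_cost_scale m0 gw) gen') (half_count_cells gw gen).
have -> : cells d.+1 (scale_family m v) w = cells d.+1 v w.
  by apply/setP => U; rewrite !inE; apply/asboolP/asboolP => /(cell_scale _ _ m0).
rewrite mulr_sumr; apply: eq_bigr => U; rewrite inE => /asboolP[Ud ind _].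
have sub V : lattice_general d.+1 finset.setT V -> lattice_general d.+1 U V.
  by move=> g k W kd WU; apply: g => //; exact: finset.subsetT.
apply: simplex_scaling => //; [exact: sub|exact: sub|].
by exists (fun=> 0) => i k _ _; rewrite add0r.
Qed.

End Triangulation.

(** * Fibers of the last projection *)

Section Fibers.
Variables (R : realType) (I : finType).
Implicit Types (S U : {set I}) (v : I -> nat -> R) (z y : nat -> R) (d : nat).
Implicit Types (lam eta w : I -> R).

Definition snoc d y (x : R) : nat -> R := fun k => if k == d then x else y k.

Lemma lattice_sumS h B d (g : (nat -> R) -> R) : lattice_sum h B d.+1 g =
  \sum_(i < B.*2.+1) lattice_sum h B d
    (fun y => g (scons (i%:R - B%:R - (if d is 0 then h else 0)) y)).
Proof. by []. Qed.

Lemma lattice_sumD h B d (g g' : (nat -> R) -> R) :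
  lattice_sum h B d (fun z => g z + g' z) = lattice_sum h B d g + lattice_sum h B d g'.
Proof.
by elim: d g g' => [//|d IH] g g'; rewrite !lattice_sumS -big_split; apply: eq_bigr.
Qed.

(** The definition peels the first coordinate, this the last; as only that one is shifted, an
    unshifted sum over the projection remains. *)
Lemma lattice_sum_last h B d (g : (nat -> R) -> R) :
  lattice_sum h B d.+1 g =
  lattice_sum 0 B d (fun y => \sum_(i < B.*2.+1) g (snoc d y (i%:R - B%:R - h))).
Proof.
elim: d g => [|d IH] g.
  rewrite /=; apply: eq_bigr => i _; congr g.
  by apply/funext => -[|k].
rewrite lattice_sumS [RHS]lattice_sumS.
have -> : (if d is 0 then 0 else 0) = 0 :> R by case: (d).
apply: eq_bigr => i _; rewrite IH.
apply: eq_lattice_sum => y _; apply: eq_bigr => j _; congr g.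
by apply/funext => -[|k].
Qed.

Lemma is_weight_snoc d S v y x lam : is_weight d.+1 S v (snoc d y x) lam <->
  is_weight d S v y lam /\ \sum_i lam i * v i d = x.
Proof.
split=> [[l0 lS l1 lz]|[[l0 lS l1 lz] ld]].
  split; last by rewrite lz// /snoc eqxx.
  by split=> // k kd; rewrite lz ?leqW//; rewrite /snoc ltn_eqF.
split=> // k; rewrite ltnS leq_eqVlt /snoc => /orP[/eqP->|kd]; first by rewrite eqxx.
by rewrite ltn_eqF// lz.
Qed.

(** An independent support lies in the graph of an integral affine function of the first [d]
    coordinates, whose value at the lattice point [y] is an integer. This is where condition (b)
    makes fibers end at integers. *)
Lemma optimal_height_int d v y lam : lattice_general d.+1 finset.setT v ->
  shifted_lattice 0 d y -> is_weight d finset.setT v y lam -> indep d (supp lam) v ->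
  \sum_i lam i * v i d \is a Num.int.
Proof.
move=> gen yint [l0 _ l1 lz] ind.
have [_ [c0 [c [c0int cint cU]]]] :=
  gen d (supp lam) (ltnSn d) (finset.subsetT _) (indep_card ind).
have -> : \sum_i lam i * v i d = c0 + \sum_(j < d) c j * y j.
  rewrite (eq_bigr (fun i => lam i * c0 + \sum_(j < d) lam i * c j * v i j)).
    rewrite big_split /= -mulr_suml l1 mul1r; congr (_ + _).
    rewrite exchange_big /=; apply: eq_bigr => j _.
    by rewrite -lz// mulr_sumr; apply: eq_bigr => i _; ring.
  move=> i _; have [iU|/suppPn ->] := boolP (i \in supp lam).
    by rewrite cU// mulrDr mulr_sumr; congr (_ + _); apply: eq_bigr => j _; rewrite mulrA.
  by rewrite !mul0r big1 ?addr0// => j _; rewrite !mul0r.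
rewrite rpredD// rpred_sum// => j _; rewrite rpredM//.
by have := yint j (ltn_ord j); case: ifP; rewrite addr0.
Qed.

Lemma fiber_count d v y B : lattice_general d.+1 finset.setT v ->
  shifted_lattice 0 d y -> (coord_bound d.+1 v <= B)%N ->
  \sum_(i < B.*2.+1) hull_ind d.+1 finset.setT v (snoc d y (i%:R - B%:R - 0)) =
  hull_ind d finset.setT v y +
  \sum_(i < B.*2.+1) hull_ind d.+1 finset.setT v (snoc d y (i%:R - B%:R - 2^-1)).
Proof.
move=> gen yint vB.
have [yh|yh] := pselect (inhull d finset.setT v y); last first.
  have snoc0 x : hull_ind d.+1 finset.setT v (snoc d y x) = 0.
    rewrite /hull_ind asboolF// => -[lam /is_weight_snoc[lamw _]].
    by apply: yh; exists lam.
  by rewrite !big1// /hull_ind asboolF// addr0.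
(* The ends of the fiber are the optimal heights for the last coordinate and its negative as costs;
   both are attained at basic weights, hence integral. *)
have [lam [lamw lami lamopt]] := optimal_weight (v^~ d) yh.
have [mu [muw mui muopt]] := optimal_weight (fun i => - v i d) yh.
pose l := \sum_i lam i * v i d; pose u := \sum_i mu i * v i d.
have lint : l \is a Num.int := optimal_height_int gen yint lamw lami.
have uint : u \is a Num.int := optimal_height_int gen yint muw mui.
have lu : l <= u := lamopt mu muw.
have bound x : inhull d.+1 finset.setT v (snoc d y x) -> `|x| <= B%:R.
  move=> /hull_bound/(_ (ltnSn d) (fun i _ => coord_boundP v i (ltnSn d))).
  rewrite /snoc eqxx => /ltW/le_trans; apply.
  by rewrite ler_nat.
have lB : `|l| <= B%:R by apply: bound; exists lam; apply/is_weight_snoc.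
have uB : `|u| <= B%:R by apply: bound; exists mu; apply/is_weight_snoc.
have hullE x : hull_ind d.+1 finset.setT v (snoc d y x) = (l <= x <= u)%R%:R.
  congr (_%:R); congr nat_of_bool; apply/asboolP/idP.
    case=> rho /is_weight_snoc[rhow <-]; rewrite lamopt//=.
    have /= := muopt rho rhow; under eq_bigr do rewrite mulrN.
    by under [leRHS]eq_bigr do rewrite mulrN; rewrite !sumrN lerN2.
  move=> /andP[lx xu].
  have [t [t0 t1 tx]] : exists t, [/\ 0 <= t, t <= 1 & (1 - t) * l + t * u = x].
    have [E|N] := eqVneq u l; first by exists 0; split=> //; lra.
    have N' : 0 < u - l by rewrite subr_gt0 lt_neqAle eq_sym N.
    exists ((x - l) / (u - l)); split; first by rewrite divr_ge0 ?subr_ge0// ltW.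
      by rewrite ler_pdivrMr//; lra.
    by field; rewrite gt_eqF.
  have [l0 _ l1 lz] := lamw; have [m0 _ m1 mz] := muw.
  have comb f : \sum_i ((1 - t) * lam i + t * mu i) * f i =
      (1 - t) * (\sum_i lam i * f i) + t * (\sum_i mu i * f i).
    by rewrite !mulr_sumr -big_split /=; apply: eq_bigr => i _; ring.
  exists (fun i => (1 - t) * lam i + t * mu i); apply/is_weight_snoc; split; last first.
    by rewrite comb.
  split.
  - by move=> i; rewrite addr_ge0 ?mulr_ge0 ?subr_ge0.
  - by move=> i; rewrite finset.in_setT.
  - by rewrite big_split /= -!mulr_sumr l1 m1; ring.
  - by move=> k kd; rewrite comb lz// mz//; ring.
under eq_bigr do rewrite hullE subr0.
under [in RHS]eq_bigr do rewrite hullE.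
rewrite (count_int_itv lint uint lu lB uB) (count_half_itv lint uint lu lB uB).
by rewrite /hull_ind asboolT// addrC.
Qed.

Definition int_count d v : R :=
  lattice_sum 0 (coord_bound d v) d (hull_ind d finset.setT v).

Lemma int_countE d v B : (coord_bound d v <= B)%N ->
  lattice_sum 0 B d (hull_ind d finset.setT v) = int_count d v.
Proof.
by move=> h; apply: shrink_hull_sum => // [|i k]; [rewrite lexx ler01|exact: coord_boundP].
Qed.

Lemma int_count_rec d v : lattice_general d.+1 finset.setT v ->
  int_count d.+1 v = int_count d v + half_count d.+1 finset.setT v.
Proof.
move=> gen; pose B := coord_bound d.+1 v.
have dB : (coord_bound d v <= B)%N.
  by rewrite leq_sum// => i _; rewrite big_ord_recr /= leq_addr.
rewrite -(int_countE dB) [LHS]/int_count /half_count !lattice_sum_last.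
rewrite -lattice_sumD; apply: eq_lattice_sum => y yint.
exact: fiber_count.
Qed.

(** In degree zero the count is that of a point: [1] as soon as the hull is nonempty. *)
Definition ehrhart_coef v k : R :=
  if k is k'.+1 then half_count k'.+1 finset.setT v else int_count 0 v.

Lemma lattice_general_le d e S v : (e <= d)%N -> lattice_general d S v -> lattice_general e S v.
Proof. by move=> ed gen k U ke; apply: gen; exact: leq_trans ed. Qed.

(** The recursion over the last coordinate telescopes down to dimension zero with the same [v]
    throughout, and each step adds one homogeneous term. *)
Lemma int_count_scale d v m : (0 < m)%N -> lattice_general d finset.setT v ->
  int_count d (scale_family m v) = \sum_(k < d.+1) ehrhart_coef v k * m%:R ^+ k.
Proof.
move=> m0; elim: d => [|d IH] gen.
  rewrite big_ord1 expr0 mulr1 /= /int_count /= /hull_ind; congr (_%:R); congr nat_of_bool.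
  by apply/asboolP/asboolP => -[lam [l0 lS l1 lz]]; exists lam.
rewrite int_count_rec; last exact: lattice_general_scale.
rewrite (IH (lattice_general_le (leqnSn d) gen)).
by rewrite [RHS]big_ord_recr /= half_count_scale// mulrC.
Qed.

End Fibers.

(** * Enumeration of lattice points, and the passage from row vectors to coordinates *)

Local Open Scope classical_set_scope.
Local Open Scope ring_scope.

Section Grid.
Variable R : realType.

Definition int_range (B : nat) : seq R := [seq i%:R - B%:R | i <- iota 0 B.*2.+1].

Fixpoint grid B d : seq (seq R) :=
  if d is d'.+1 then [seq x :: s | x <- int_range B, s <- grid B d'] else [:: [::]].

Lemma gridS B d : grid B d.+1 = [seq x :: s | x <- int_range B, s <- grid B d].
Proof. by []. Qed.

Lemma grid_uniq B d : uniq (grid B d).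
Proof.
elim: d => [//|d IH]; rewrite gridS; apply: allpairs_uniq => //; last first.
  by move=> [x s] [x' s'] _ _ /= [-> ->].
rewrite map_inj_uniq ?iota_uniq// => i j /addIr/eqP.
by rewrite eqr_nat => /eqP.
Qed.

Lemma mem_int_range B (x : R) : x \is a Num.int -> `|x| <= B%:R -> x \in int_range B.
Proof.
move=> xint xB; have [p pB ->] := int_subnatP xint xB.
by apply/mapP; exists p => //; rewrite mem_iota add0n ltnS.
Qed.

Lemma mem_grid B d (s : seq R) : size s = d ->
  {in s, forall x, x \is a Num.int /\ `|x| <= B%:R} -> s \in grid B d.
Proof.
elim: d s => [|d IH] [|x s] // [sd] h; rewrite gridS; apply/allpairsP; exists (x, s); split=> //=.
  by have [] := h x (mem_head _ _); exact: mem_int_range.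
by apply: IH => // y ys; apply: h; rewrite inE ys orbT.
Qed.

Lemma grid_mem B d (s : seq R) : s \in grid B d -> size s = d /\ {in s, forall x, x \is a Num.int}.
Proof.
elim: d s => [|d IH] s; first by rewrite inE => /eqP ->.
rewrite gridS; case/allpairsP => -[x t] /= [/mapP[i _ ->] /IH[td tint] ->] /=; rewrite td; split=> // y.
by rewrite inE => /orP[/eqP ->|/tint//]; exact: int_subnat.
Qed.

Lemma lattice_sum_grid B d (g : (nat -> R) -> R) :
  lattice_sum 0 B d g = \sum_(s <- grid B d) g (nth 0 s).
Proof.
elim: d g => [|d IH] g.
  by rewrite /= big_seq1; congr g; apply/funext => k; rewrite nth_nil.
rewrite lattice_sumS [RHS]big_allpairs_dep big_map.
transitivity (\sum_(0 <= i < B.*2.+1) \sum_(s <- grid B d) g (nth 0 (i%:R - B%:R :: s))).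
  rewrite big_mkord; apply: eq_bigr => i _; rewrite IH; apply: eq_bigr => s _; congr g.
  have -> : (if d is 0 then 0 else 0) = 0 :> R by case: (d).
  by rewrite subr0; apply/funext => -[|k].
by rewrite /index_iota subn0.
Qed.

End Grid.

Section Coordinates.
Variable R : realType.

Definition coords d (x : 'rV[R]_d) : nat -> R :=
  fun k => if insub k is Some i then x ord0 i else 0.

Lemma coordE d (x : 'rV[R]_d) k (kd : (k < d)%N) : coords x k = x ord0 (Ordinal kd).
Proof. by rewrite /coords insubT. Qed.

Lemma coord_ord d (x : 'rV[R]_d) (i : 'I_d) : coords x i = x ord0 i.
Proof. by rewrite /coords valK. Qed.

Lemma coord_inj d (x y : 'rV[R]_d) : (forall k, (k < d)%N -> coords x k = coords y k) -> x = y.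
Proof. by move=> h; apply/rowP => i; rewrite -!coord_ord h. Qed.

Definition to_row d (f : nat -> R) : 'rV[R]_d := \row_i f i.

Lemma coord_to_row d f k : (k < d)%N -> coords (to_row d f) k = f k.
Proof. by move=> kd; rewrite coordE mxE. Qed.

Lemma coordZ d a (x : 'rV[R]_d) k : coords (a *: x) k = a * coords x k.
Proof. by rewrite /coords; case: insub => [i|]; rewrite ?mxE ?mulr0. Qed.

Lemma coordD d (x y : 'rV[R]_d) k : coords (x + y) k = coords x k + coords y k.
Proof. by rewrite /coords; case: insub => [i|]; rewrite ?mxE ?addr0. Qed.

Lemma coord_sum d (J : Type) (r : seq J) (x : J -> 'rV[R]_d) k :
  coords (\sum_(j <- r) x j) k = \sum_(j <- r) coords (x j) k.
Proof.
elim: r => [|j r IH]; last by rewrite !big_cons coordD IH.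
by rewrite !big_nil /coords; case: insub => // i; rewrite mxE.
Qed.

Variable I : finType.
Implicit Types (v : I -> nat -> R).

Lemma eq_inhull d S v (z z' : nat -> R) : (forall k, (k < d)%N -> z k = z' k) ->
  inhull d S v z -> inhull d S v z'.
Proof. by move=> zz' [lam [l0 lS l1 lz]]; exists lam; split=> // k kd; rewrite -zz' ?lz. Qed.

(** The bridge between sets of row vectors and indexed families. Only the first [d] coordinates are
    compared, so a projection is modelled by the same [v]. *)
Definition hull_model d (Q : set 'rV[R]_d) v :=
  forall x, Q x <-> inhull d finset.setT v (coords x).

Definition lattice_points d v : seq 'rV[R]_d :=
  [seq to_row d (nth 0 s) | s <- grid R (coord_bound d v) d & `[< inhull d finset.setT v (nth 0 s) >]].

Lemma size_lattice_points d v : (size (lattice_points d v))%:R = int_count d v.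
Proof.
rewrite /lattice_points size_map size_filter /int_count lattice_sum_grid /hull_ind.
by rewrite -sum1_count natr_sum big_mkcond; apply: eq_bigr => s _; case: asboolP.
Qed.

Lemma lattice_points_uniq d v : uniq (lattice_points d v).
Proof.
rewrite map_inj_in_uniq ?filter_uniq ?grid_uniq// => s t.
rewrite !mem_filter => /andP[_ /grid_mem[sd _]] /andP[_ /grid_mem[td _]] st.
apply: (eq_from_nth (x0 := 0)) => [|k]; first by rewrite sd td.
rewrite sd => kd; have := congr1 (fun x => coords x k) st.
by rewrite !coord_to_row.
Qed.

Lemma mem_lattice_points d v x :
  x \in lattice_points d v <-> lattice x /\ inhull d finset.setT v (coords x).
Proof.
split.
  case/mapP => s; rewrite mem_filter => /andP[/asboolP sh /grid_mem[sd sint]] ->.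
  split; last by apply: eq_inhull sh => k kd; rewrite coord_to_row.
  by move=> i; rewrite mxE sint// mem_nth ?sd.
move=> [xint xh]; apply/mapP; exists [seq coords x k | k <- iota 0 d]; last first.
  apply: coord_inj => k kd; rewrite coord_to_row// (nth_map 0%N) ?size_iota//.
  by rewrite nth_iota.
rewrite mem_filter; apply/andP; split.
  apply/asboolP; apply: eq_inhull xh => k kd.
  by rewrite (nth_map 0%N) ?size_iota// nth_iota.
apply: mem_grid; first by rewrite size_map size_iota.
move=> _ /mapP[k + ->]; rewrite mem_iota add0n /= => kd; split.
  by rewrite coordE; exact: xint.
by rewrite ltW// (hull_bound xh kd)// => i _; exact: coord_boundP.
Qed.

Lemma hull_model_scale d (P : set 'rV[R]_d) v m : (0 < m)%N -> hull_model P v ->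
  hull_model ((fun x => m%:R *: x) @` P) (scale_family m v).
Proof.
move=> m0 Pv x; have mN0 : m%:R != 0 :> R by rewrite pnatr_eq0 -lt0n.
split.
  case=> y /Pv[lam [l0 lS l1 lz]] <-; exists lam; split=> // k kd; rewrite coordZ -lz// mulr_sumr.
  by apply: eq_bigr => i _; rewrite mulrCA.
move=> [lam [l0 lS l1 lz]]; exists (m%:R^-1 *: x); last by rewrite scalerA divff// scale1r.
apply/Pv; exists lam; split=> // k kd; rewrite coordZ -lz// mulr_sumr.
by apply: eq_bigr => i _; rewrite /scale_family mulrCA mulKf.
Qed.

Lemma lattice_count_model d Q v m : (0 < m)%N -> hull_model (d := d) Q v ->
  (lattice_count Q m)%:R = int_count d (scale_family m v).
Proof.
move=> m0 /(hull_model_scale m0) Qv; rewrite /lattice_count.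
have -> : (fun x => m%:R *: x) @` Q `&` lattice (k := d) =
    [set` [fset x in lattice_points d (scale_family m v)]%fset].
  apply/seteqP; split=> x; rewrite /= inE.
    by move=> [/Qv xh xint]; apply/mem_lattice_points.
  by move=> /mem_lattice_points[xint /Qv].
by rewrite set_fsetK card_fseq undup_id ?lattice_points_uniq// size_lattice_points.
Qed.

Lemma hull_model_proj_last d (P : set 'rV[R]_d) v :
  hull_model P v -> hull_model (proj_last (k := d) @` P) v.
Proof.
move=> Pv x; split.
  case=> y /Pv[lam [l0 lS l1 lz]] <-; exists lam; split=> // k kd.
  by rewrite lz ?(leq_trans kd (leq_pred d))// [RHS]coordE mxE -coord_ord.
move=> [lam [l0 lS l1 lz]]; exists (to_row d (fun k => \sum_i lam i * v i k)).
  by apply/Pv; exists lam; split=> // k kd; rewrite coord_to_row.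
by apply: coord_inj => k kd; rewrite -lz// coordE !mxE.
Qed.

Lemma hull_model_proj_forget d j (P : set 'rV[R]_d) v :
  hull_model P v -> hull_model (proj_forget (k := d) j @` P) v.
Proof.
move=> Pv x; split.
  case=> y /Pv[lam [l0 lS l1 lz]] <-; exists lam; split=> // k kd.
  by rewrite lz ?(leq_trans kd (leq_subr j d))// [RHS]coordE mxE -coord_ord.
move=> [lam [l0 lS l1 lz]]; exists (to_row d (fun k => \sum_i lam i * v i k)).
  by apply/Pv; exists lam; split=> // k kd; rewrite coord_to_row.
by apply: coord_inj => k kd; rewrite -lz// coordE !mxE.
Qed.

End Coordinates.

(** * Volume as a growth rate *)

Section VolumeUpper.
Variable R : realType.

(** The difference is of order [M ^ (d - 1)]; multiplying by [M] avoids the predecessor of [d]. *)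
Lemma shifted_power_bound (s : R) d : 0 <= s -> exists2 C, 0 <= C &
  forall M : R, 1 <= M -> M * ((M + s) ^+ d - M ^+ d) <= C * M ^+ d.
Proof.
move=> s0; elim: d => [|d [C C0 IH]]; first by exists 0 => // M M1; rewrite !expr0 subrr mulr0 mul0r.
exists ((1 + s) * C + s) => [|M M1]; first by rewrite addr_ge0 ?mulr_ge0 ?addr_ge0.
have M0 : 0 <= M by lra.
have := IH M M1; set X := _ ^+ d - _ => h.
have -> : (M + s) ^+ d.+1 - M ^+ d.+1 = (M + s) * X + s * M ^+ d.
  by rewrite /X !exprS; ring.
rewrite [leRHS]mulrDl mulrDr lerD//; last by rewrite exprS mulrCA.
have Ms : M + s <= (1 + s) * M by have := ler_wpM2l s0 M1; lra.
apply: (@le_trans _ _ ((M + s) * (C * M ^+ d))).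
  by rewrite mulrCA ler_wpM2l//; lra.
rewrite exprS mulrACA -[X in _ <= X]mulrA.
have : 0 <= C * M ^+ d by rewrite mulr_ge0// exprn_ge0.
by move=> CM; have := ler_wpM2r CM Ms; lra.
Qed.

Lemma poly_leading_bound (c : nat -> R) (s : R) d : 0 <= s -> exists2 C, 0 <= C &
  forall M : R, 1 <= M ->
    M * `|\sum_(k < d.+1) c k * (M + s) ^+ k - c d * M ^+ d| <= C * M ^+ d.
Proof.
move=> s0; have [C C0 CP] := shifted_power_bound d s0.
exists (\sum_(k < d) `|c k| * (1 + s) ^+ k + `|c d| * C) => [|M M1].
  by rewrite addr_ge0 ?mulr_ge0// sumr_ge0// => k _; rewrite mulr_ge0// exprn_ge0// addr_ge0.
have M0 : 0 <= M by lra.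
rewrite big_ord_recr /= -addrA -mulrBr.
apply: (@le_trans _ _ (M * (\sum_(k < d) `|c k| * (M + s) ^+ k + `|c d| * ((M + s) ^+ d - M ^+ d)))).
  rewrite ler_wpM2l// (le_trans (ler_normD _ _))// lerD//; last first.
    rewrite normrM ler_wpM2l// ger0_norm// subr_ge0 lerXn2r ?nnegrE//; lra.
  apply: (le_trans (ler_norm_sum _ _ _)); apply: ler_sum => k _.
  by rewrite normrM ler_wpM2l// ger0_norm// exprn_ge0// addr_ge0.
rewrite [leRHS]mulrDl mulrDr lerD//; last first.
  by rewrite mulrCA -mulrA ler_wpM2l// CP.
rewrite mulr_sumr mulr_suml; apply: ler_sum => k _.
rewrite mulrCA -mulrA ler_wpM2l//.
have h1 : (M + s) ^+ k <= ((1 + s) * M) ^+ k.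
  by rewrite lerXn2r ?nnegrE ?mulr_ge0 ?addr_ge0//; have := ler_wpM2l s0 M1; lra.
apply: (@le_trans _ _ (M * ((1 + s) * M) ^+ k)); first by rewrite ler_wpM2l.
rewrite exprMn mulrCA ler_wpM2l ?exprn_ge0 ?addr_ge0// -exprS.
by rewrite ler_weXn2l.
Qed.

Lemma le_of_inv_bound (x y C : R) : 0 <= C ->
  (forall M : nat, (0 < M)%N -> M%:R * x <= M%:R * y + C) -> x <= y.
Proof.
move=> C0 h; rewrite leNgt; apply/negP => yx.
have xy0 : 0 < x - y by rewrite subr_gt0.
pose M := (Num.truncn (C / (x - y))).+1.
have := h M isT; have : C / (x - y) < M%:R by exact: truncnS_gt.
by rewrite ltr_pdivrMr//; lra.
Qed.

Variable I : finType.
Implicit Types (v : I -> nat -> R).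

(** Each unit vector is a combination of the points with total weight zero: the directions of the
    affine span fill the space. This form passes to projections and supplies the perturbations of
    [hull_contains_cube]. *)
Definition full_dim d v := (0 < #|I|)%N /\ forall j, (j < d)%N ->
  exists eta : I -> R, \sum_i eta i = 0 /\
    forall k, (k < d)%N -> \sum_i eta i * v i k = (k == j)%:R.

(** At the barycenter all weights equal [n^-1] and can be perturbed along the [eta j]; a large
    dilation [s] makes the required perturbations small. *)
Lemma hull_contains_cube d v : full_dim d v -> exists (s : nat) (z : nat -> R),
  [/\ (0 < s)%N, forall k, z k \is a Num.int &
   forall y, (forall k, (k < d)%N -> `|y k - z k| <= 1) ->
     inhull d finset.setT (scale_family s v) y].
Proof.
case=> I0 etaP.
have E_ (j : 'I_d) := cid (etaP j (ltn_ord j)).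
pose eta j := sval (E_ j).
have eta1 j : \sum_i eta j i = 0 by case: (svalP (E_ j)).
have etav j k : (k < d)%N -> \sum_i eta j i * v i k = (k == j)%:R.
  by case: (svalP (E_ j)) => _; apply.
pose n : R := #|I|%:R.
have n0 : 0 < n by rewrite ltr0n.
pose K := 1 + \sum_j \sum_i `|eta j i|.
have K0 : 0 < K by rewrite ltr_wpDr// sumr_ge0// => j _; rewrite sumr_ge0.
(* Each coordinate deviates from the dilated barycenter by at most [2]: one unit from the cube, one
   from rounding its center down to [z]. The factor [K] bounds the effect on the weights. *)
pose s := (Num.truncn (2 * n * K)).+1.
have sK : 2 * n * K < s%:R by exact: truncnS_gt.
have s0 : 0 < s%:R :> R by rewrite ltr0n.
pose p k := n^-1 * \sum_i v i k.
pose z k : R := (Num.floor (s%:R * p k))%:~R.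
exists s, z; split=> // [k|y yz]; first exact: intr_int.
pose t (j : 'I_d) := y j / s%:R - p j.
have tb j : `|t j| <= 2 / s%:R.
  have -> : t j = (y j - s%:R * p j) / s%:R by rewrite /t; field; rewrite gt_eqF.
  rewrite normrM [X in _ * X]gtr0_norm ?invr_gt0// ler_pM2r ?invr_gt0//.
  have := yz j (ltn_ord j); have := floor_itv (s%:R * p j); rewrite /z rmorphD/=.
  by move=> /andP[h1 h2]; rewrite !ler_norml => /andP[h3 h4]; apply/andP; split; lra.
exists (fun i => n^-1 + \sum_j t j * eta j i); split.
- move=> i; have : `|\sum_j t j * eta j i| <= n^-1.
    apply: (@le_trans _ _ (2 / s%:R * K)); last first.
      rewrite -[leRHS]mul1r ler_pdivlMr//.
      have -> : 2 / s%:R * K * n = 2 * n * K / s%:R by ring.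
      by rewrite ler_pdivrMr// mul1r ltW.
    apply: (le_trans (ler_norm_sum _ _ _)).
    apply: (@le_trans _ _ (\sum_j 2 / s%:R * `|eta j i|)).
      by apply: ler_sum => j _; rewrite normrM ler_wpM2r.
    rewrite -mulr_sumr ler_wpM2l ?divr_ge0//.
    apply: (@le_trans _ _ (\sum_j \sum_i `|eta j i|)); last by rewrite /K lerDr.
    by apply: ler_sum => j _; rewrite (bigD1 i)//= lerDl sumr_ge0.
  by rewrite ler_norml => /andP[h _]; lra.
- by move=> i; rewrite finset.in_setT.
- rewrite big_split /= sumr_const -mulr_natr mulVf ?gt_eqF// exchange_big /= big1 ?addr0// => j _.
  by rewrite -mulr_sumr eta1 mulr0.
move=> k kd; under eq_bigr do rewrite mulrDl mulr_suml.
rewrite big_split /= exchange_big /=.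
have -> : \sum_i n^-1 * scale_family s v i k = s%:R * p k.
  by rewrite /p mulrCA !mulr_sumr; apply: eq_bigr => i _; rewrite /scale_family; ring.
have -> : \sum_j \sum_i t j * eta j i * scale_family s v i k = s%:R * t (Ordinal kd).
  rewrite (bigD1 (Ordinal kd))//= [X in _ + X]big1 ?addr0 => [|j jk].
    transitivity (s%:R * t (Ordinal kd) * \sum_i eta (Ordinal kd) i * v i k).
      by rewrite mulr_sumr; apply: eq_bigr => i _; rewrite /scale_family; ring.
    by rewrite etav// eqxx mulr1.
  transitivity (s%:R * t j * \sum_i eta j i * v i k).
    by rewrite mulr_sumr; apply: eq_bigr => i _; rewrite /scale_family; ring.
  by rewrite etav// -(inj_eq val_inj) /= eq_sym in jk *; rewrite (negPf jk) mulr0.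
by rewrite /t /=; field; rewrite gt_eqF.
Qed.

Lemma inhull_add d v (M s : nat) x y : (0 < M + s)%N ->
  inhull d finset.setT (scale_family M v) x ->
  inhull d finset.setT (scale_family s v) y ->
  inhull d finset.setT (scale_family (M + s) v) (fun k => x k + y k).
Proof.
move=> Ms0 [lam [l0 _ l1 lz]] [mu [m0 _ m1 mz]].
have MsN : M%:R + s%:R != 0 :> R by rewrite -natrD pnatr_eq0 -lt0n.
exists (fun i => (M%:R * lam i + s%:R * mu i) / (M%:R + s%:R)); split.
- by move=> i; rewrite divr_ge0 ?addr_ge0 ?mulr_ge0.
- by move=> i; rewrite finset.in_setT.
- by rewrite -mulr_suml big_split /= -!mulr_sumr l1 m1 !mulr1 divff.
move=> k kd; rewrite -lz// -mz// -big_split /=; apply: eq_bigr => i _.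
by rewrite /scale_family natrD; field.
Qed.

(** Cover by cubes of side [M^-1]. With [x] the floor of [M q], the point [x + z] is [M q] plus a
    point of the cube around [z], so it lies in the dilate by [M + s]; the lattice points there
    index the cubes. *)
Lemma Vol_le_count d (Q : set 'rV[R]_d) v : hull_model Q v -> full_dim d v ->
  exists s : nat, forall M, (0 < M)%N ->
    (Vol Q <= (int_count d (scale_family (M + s) v) / M%:R ^+ d)%:E)%E.
Proof.
move=> Qv /hull_contains_cube[s [z [s0 zint cube]]]; exists s => M M0.
have M0' : 0 < M%:R :> R by rewrite ltr0n.
pose L := lattice_points d (scale_family (M + s) v).
pose y_ n : 'rV[R]_d := nth 0 L n.
pose a n : 'rV[R]_d := \row_i (M%:R^-1 * (y_ n ord0 i - z i)).
pose b n : 'rV[R]_d := \row_i (M%:R^-1 * (y_ n ord0 i - z i + 1)).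
have bvol n : box_vol (a n) (b n) = M%:R^-1 ^+ d.
  rewrite /box_vol (eq_bigr (fun=> M%:R^-1)) ?prodr_const ?card_ord// => i _.
  by rewrite !mxE; ring.
apply: ereal_inf_lbound; exists a, b, (fun n => (n < size L)%N); split.
- by move=> n i; rewrite !mxE ler_wpM2l ?invr_ge0 ?(ltW M0')// lerDl.
- move=> q Qq.
  pose x k : R := (Num.floor (M%:R * coords q k))%:~R.
  have xb k : x k <= M%:R * coords q k <= x k + 1.
    have := floor_itv (M%:R * coords q k); rewrite rmorphD/= -/(x k).
    by move=> /andP[h1 h2]; rewrite h1/= ltW.
  pose y := to_row d (fun k => x k + z k).
  have yL : y \in L.
    apply/mem_lattice_points; split.
      by move=> i; rewrite mxE rpredD ?intr_int.
    have h1 : inhull d finset.setT (scale_family M v) (fun k => M%:R * coords q k).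
      have [lam [l0 lS l1 lz]] := (Qv q).1 Qq; exists lam; split=> // k kd.
      by rewrite -lz// mulr_sumr; apply: eq_bigr => i _; rewrite mulrCA.
    have h2 : inhull d finset.setT (scale_family s v) (fun k => x k - M%:R * coords q k + z k).
      apply: cube => k _; rewrite addrK ler_norml; have := xb k.
      by move=> /andP[? ?]; apply/andP; split; lra.
    have Ms0 : (0 < M + s)%N by rewrite addn_gt0 M0.
    apply: eq_inhull (inhull_add Ms0 h1 h2) => k kd.
    by rewrite coord_to_row//; ring.
  exists (index y L) => /=; first by rewrite index_mem.
  move=> i; rewrite /a /b /y_ nth_index// !mxE addrK -coord_ord.
  by rewrite ler_pdivrMl// ler_pdivlMl// xb.
rewrite (nneseries_split 0 (size L)); last by move=> k _; case: ifP; rewrite ?bvol ?lee_fin ?exprn_ge0 ?invr_ge0.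
rewrite eseries0 ?adde0; last by move=> k; rewrite add0n leqNgt => /negPf ->.
rewrite add0n (eq_big_nat _ _ (F2 := fun=> (M%:R^-1 ^+ d)%:E)); last first.
  by move=> k /andP[_ ->]; rewrite bvol.
rewrite sumEFin sumr_const_nat subn0 -size_lattice_points -/L.
by rewrite -[_ ^+ d *+ _]mulr_natl exprVn.
Qed.

Lemma Vol_upper d (Q : set 'rV[R]_d) v (c : nat -> R) : hull_model Q v -> full_dim d v ->
  (forall m, (0 < m)%N -> int_count d (scale_family m v) = \sum_(k < d.+1) c k * m%:R ^+ k) ->
  (Vol Q <= (c d)%:E)%E.
Proof.
move=> Qv fv cE; have [s sP] := Vol_le_count Qv fv.
have [C C0 CP] := poly_leading_bound c d (ler0n R s).
apply/lee_addgt0Pr => e e0.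
pose M := (Num.truncn (C / e)).+1.
have M1 : 1 <= M%:R :> R by rewrite ler1n.
have M0 : 0 < M%:R :> R by rewrite ltr0n.
have Md : 0 < M%:R ^+ d :> R by rewrite exprn_gt0.
apply: (le_trans (sP M isT)); rewrite -EFinD lee_fin cE ?addn_gt0// natrD.
rewrite ler_pdivrMr// mulrDl -lerBlDl.
have := CP _ M1; set X := _ - _ => h.
have {}h : M%:R * X <= C * M%:R ^+ d by apply: le_trans h; rewrite ler_pM2l// ler_norm.
rewrite -(ler_pM2l M0) (le_trans h)// mulrA ler_pM2r//.
have : C / e < M%:R by exact: truncnS_gt.
by rewrite ltr_pdivrMr// => /ltW.
Qed.

End VolumeUpper.

(** * Lower bounds for volumes: compactness and finite covers *)

Section Compactness.
Import numFieldNormedType.Exports.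
Variables (R : realType) (I : finType).

Lemma row_form_continuous n (c : 'I_n -> R) :
  continuous (fun x : 'rV[R]_n => \sum_j x ord0 j * c j).
Proof.
apply: continuous_big => [|j _ x]; first exact: add_continuous.
apply: (@continuous_comp _ _ _ (fun M : 'rV[R]_n => M ord0 j) ( *%R^~ (c j))).
  exact: coord_continuous.
exact: mulrr_continuous.
Qed.

(** Compactness is applied to the simplex of weights, a closed part of a cube. [is_weight 0] imposes
    no coordinate condition, so [lam] ranges over all weights and the sums over all points of the
    hull. *)
Lemma weights_finite_cover d (v : I -> nat -> R) (a b : nat -> nat -> R) (D : set nat) :
  (forall lam, is_weight 0 finset.setT v (fun=> 0) lam -> exists2 n, D n &
     forall k : 'I_d, a n k < \sum_i lam i * v i k < b n k) ->
  exists2 r : seq nat, {in r, forall n, D n} &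
    forall lam, is_weight 0 finset.setT v (fun=> 0) lam -> exists2 n, n \in r &
      forall k : 'I_d, a n k < \sum_i lam i * v i k < b n k.
Proof.
move=> cov.
pose W := [set w : 'rV[R]_#|I| | forall j, `[0, 1]%classic (w ord0 j)] `&`
          [set w : 'rV[R]_#|I| | \sum_j w ord0 j * 1 = 1].
have Wc : compact W.
  apply: compact_closedI; first by apply: (@rV_compact R _ (fun=> `[0, 1]%classic)) => _; exact: segment_compact.
  apply: (@preimage_closed _ _ (fun w : 'rV[R]_#|I| => \sum_j w ord0 j * 1) [set 1]).
    by move=> w _; exact: row_form_continuous.
  exact: closed_eq.
pose form k (w : 'rV[R]_#|I|) := \sum_j w ord0 j * v (enum_val j) k.
pose f n := [set w : 'rV[R]_#|I| | forall k : 'I_d, a n k < form k w < b n k].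
have fo n : D n -> open (f n).
  move=> _; rewrite openE => w wf; have Fw := nbhs_filter w.
  apply: (@filter_forall _ _ _ _ Fw) => k.
  have /andP[h1 h2] := wf k.
  have fc : form k w' @[w' --> w] --> form k w.
    exact: (@row_form_continuous _ (fun j => v (enum_val j) k) w).
  near=> w'; apply/andP; split; near: w'.
    exact: (cvgr_gt _ fc).
  exact: (cvgr_lt _ fc).
have sumE (w : 'rV[R]_#|I|) c : \sum_j w ord0 j * c (enum_val j) = \sum_i w ord0 (enum_rank i) * c i.
  rewrite [RHS](reindex (@enum_val _ I))/=; last first.
    by exists enum_rank => i _; [exact: enum_valK|exact: enum_rankK].
  by apply: eq_bigr => j _; rewrite enum_valK.
have Wcov : W `<=` cover D f.
  move=> w [w01 w1].
  have [|n Dn nP] := cov (fun i => w ord0 (enum_rank i)).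
    split=> //.
    - by move=> i; have := w01 (enum_rank i); rewrite /= in_itv/= => /andP[].
    - by move=> i; rewrite finset.in_setT.
    - by rewrite -[RHS]w1 (sumE w (fun=> 1)); apply: eq_bigr => i _; rewrite mulr1.
  by exists n => // k; rewrite /form (sumE w (v^~ k)).
move: Wc; rewrite compact_cover => /(_ _ _ _ fo Wcov)[E ED Ecov].
exists E => [n nE|lam [l0 _ l1 _]]; first by have /set_mem := ED n nE.
pose w : 'rV[R]_#|I| := \row_j lam (enum_val j).
have wE i : w ord0 (enum_rank i) = lam i by rewrite mxE enum_rankK.
have Ww : W w.
  split=> [j|].
    rewrite /= in_itv/= mxE l0/= -l1 (bigD1 (enum_val j))//= lerDl.
    by apply: sumr_ge0.
  by rewrite /= (sumE w (fun=> 1)) -[RHS]l1; apply: eq_bigr => i _; rewrite wE mulr1.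
have [n nE nP] := Ecov w Ww; exists n => // k.
have := nP k; rewrite /form (sumE w (v^~ k)).
by under eq_bigr do rewrite wE.
Unshelve. all: by end_near.
Qed.

End Compactness.

Section VolumeLower.
Variable R : realType.

Lemma count_itv_le n (x y : R) : x <= y + 1 ->
  \sum_(i < n) (x <= i%:R <= y)%R%:R <= y - x + 1.
Proof.
(* The induction needs the interval cut at [n - 1], the last index counted so far; the maximum with
   [0] covers the indices before [x]. *)
move=> xy; apply: (@le_trans _ _ (Num.max 0 (Num.min (n%:R - 1) y - x + 1))); last first.
  rewrite ge_max; apply/andP; split; first lra.
  by rewrite !lerD2r ge_min lexx orbT.
elim: n => [|n IH]; first by rewrite big_ord0 le_max lexx.
rewrite big_ord_recr /= -natr1 addrK.
case: (boolP (x <= n%:R <= y)) => [/andP[xn ny]|_] /=; last first.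
  rewrite addr0 (le_trans IH)// ge_max !le_max lexx /= ; apply/orP; right.
  by rewrite !lerD2r le_min !ge_min lexx orbT andbT; apply/orP; left; lra.
rewrite min_l// [leRHS]max_r; last lra.
rewrite lerD2r (le_trans IH)// ge_max; apply/andP; split; first lra.
have : Num.min (n%:R - 1) y <= n%:R - 1 by rewrite ge_min lexx.
by lra.
Qed.

Lemma lattice_sumZ h B d c (g : (nat -> R) -> R) :
  lattice_sum h B d (fun z => c * g z) = c * lattice_sum h B d g.
Proof.
elim: d g => [//|d IH] g; rewrite !lattice_sumS mulr_sumr.
by apply: eq_bigr => i _; rewrite IH.
Qed.

Lemma lattice_sum_prod B d (f : nat -> R -> R) :
  lattice_sum 0 B d (fun z => \prod_(k < d) f k (z k)) =
  \prod_(k < d) \sum_(i < B.*2.+1) f k (i%:R - B%:R).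
Proof.
elim: d f => [|d IH] f; first by rewrite /= !big_ord0.
rewrite lattice_sumS [RHS]big_ord_recl mulr_suml; apply: eq_bigr => i _.
rewrite -(IH (fun k => f k.+1)) -lattice_sumZ; apply: eq_lattice_sum => y _.
rewrite big_ord_recl /=; congr (f _ _ * _).
by case: (d); rewrite subr0.
Qed.

Lemma box_lattice_sum B d (a b : nat -> R) : (forall k, (k < d)%N -> a k <= b k) ->
  lattice_sum 0 B d (fun z => \prod_(k < d) (a k <= z k <= b k)%R%:R) <=
  \prod_(k < d) (b k - a k + 1).
Proof.
move=> ab; rewrite (lattice_sum_prod B d (fun k t => (a k <= t <= b k)%R%:R)).
apply: ler_prod => k _; rewrite sumr_ge0//=.
under eq_bigr do rewrite lerBrDr lerBlDr.
have := ab k (ltn_ord k) => abk.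
by apply: (le_trans (count_itv_le _ _)); lra.
Qed.

(** Linear control in [e], from [e ^ 2 <= e] on the unit interval. It serves both the extra lattice
    point per side, with [e = M^-1], and the opening of closed boxes. *)
Lemma prod_bump n (s : nat -> R) : (forall k, 0 <= s k) -> exists2 K, 0 <= K &
  forall e, 0 <= e <= 1 -> \prod_(k < n) (s k + e) <= \prod_(k < n) s k + K * e.
Proof.
move=> s0; elim: n => [|n [K K0 IH]].
  by exists 0 => // e _; rewrite !big_ord0 mul0r addr0.
have P0 : 0 <= \prod_(k < n) s k by rewrite prodr_ge0.
exists (s n * K + \prod_(k < n) s k + K) => [|e /andP[e0 e1]].
  by rewrite !addr_ge0// mulr_ge0.
rewrite !big_ord_recr /=.
have h : \prod_(k < n) (s k + e) <= \prod_(k < n) s k + K * e by rewrite IH// e0.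
apply: (le_trans (ler_wpM2r (_ : 0 <= s n + e) h)); first by rewrite addr_ge0.
have : K * e * e <= K * e by rewrite -[leRHS]mulr1 ler_wpM2l// mulr_ge0.
by lra.
Qed.

Variable I : finType.
Implicit Types (v : I -> nat -> R).

Lemma scaled_count_le d v (r : seq nat) (a b : nat -> nat -> R) (M : nat) : (0 < M)%N ->
  (forall n k, (k < d)%N -> a n k <= b n k) ->
  (forall lam, is_weight 0 finset.setT v (fun=> 0) lam -> exists2 n, n \in r &
      forall k : 'I_d, a n k < \sum_i lam i * v i k < b n k) ->
  int_count d (scale_family M v) <= \sum_(n <- r) \prod_(k < d) (M%:R * (b n k - a n k) + 1).
Proof.
move=> M0 ab cov; have M0' : 0 < M%:R :> R by rewrite ltr0n.
rewrite /int_count; set B := coord_bound _ _.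
apply: (@le_trans _ _ (lattice_sum 0 B d (fun z => \sum_(n <- r) 1 *
    \prod_(k < d) (M%:R * a n k <= z k <= M%:R * b n k)%R%:R))).
  apply: ler_lattice_sum => z _.
  have nonneg n : 0 <= \prod_(k < d) (M%:R * a n k <= z k <= M%:R * b n k)%R%:R :> R.
    by rewrite prodr_ge0.
  rewrite /hull_ind; case: asboolP => [[lam [l0 lS l1 lz]]|_]; last first.
    by apply: sumr_ge0 => n _; rewrite mul1r.
  have [|n nr nP] := cov lam; first by split.
  rewrite (big_rem n)//= mul1r big1 ?lerDl ?sumr_ge0//.
    by move=> k _; rewrite mul1r.
  move=> k _; have := nP k; rewrite -lz// => /andP[h1 h2].
  have -> : \sum_i lam i * scale_family M v i k = M%:R * \sum_i lam i * v i k.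
    by rewrite mulr_sumr; apply: eq_bigr => i _; rewrite mulrCA.
  by rewrite !ler_pM2l// (ltW h1) (ltW h2).
rewrite (lattice_sum_lin _ _ _ _ (fun=> 1)).
apply: ler_sum => n _; rewrite mul1r.
have Mab k : (k < d)%N -> M%:R * a n k <= M%:R * b n k by move=> kd; rewrite ler_pM2l// ab.
apply: (le_trans (box_lattice_sum B Mab)).
by rewrite le_eqVlt; apply/orP; left; apply/eqP; apply: eq_bigr => k _; rewrite mulrBr.
Qed.

(** A box dilated by [M] has at most [M] times its side plus [1] lattice points along each axis.
    After division by [M ^ d] the extra [1] disappears as [M] grows, and so do the lower terms of
    the count. *)
Lemma leading_coef_le_cover d v (c : nat -> R) (r : seq nat) (a b : nat -> nat -> R) :
  (forall m, (0 < m)%N -> int_count d (scale_family m v) = \sum_(k < d.+1) c k * m%:R ^+ k) ->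
  (forall n k, a n k <= b n k) ->
  (forall lam, is_weight 0 finset.setT v (fun=> 0) lam -> exists2 n, n \in r &
      forall k : 'I_d, a n k < \sum_i lam i * v i k < b n k) ->
  c d <= \sum_(n <- r) \prod_(k < d) (b n k - a n k).
Proof.
move=> cE ab cov.
have [C C0 CP] := poly_leading_bound c d (lexx (0 : R)).
have K_ n : exists K, 0 <= K /\ forall e, 0 <= e <= 1 ->
    \prod_(k < d) (b n k - a n k + e) <= \prod_(k < d) (b n k - a n k) + K * e.
  have [|K K0 KP] := @prod_bump d (fun k => b n k - a n k); first by move=> k; rewrite subr_ge0.
  by exists K.
have [K KP] := choice K_.
apply: (@le_of_inv_bound _ _ _ (C + \sum_(n <- r) K n)) => [|M M0].
  by rewrite addr_ge0// sumr_ge0// => n _; case: (KP n).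
have M1 : 1 <= M%:R :> R by rewrite ler1n.
have M0' : 0 < M%:R :> R by rewrite ltr0n.
have Md : 0 < M%:R ^+ d :> R by rewrite exprn_gt0.
have := CP _ M1; rewrite addr0 -cE//.
have := @scaled_count_le d v r a b M M0 (fun n k _ => ab n k) cov.
set N := int_count _ _ => hN hC.
have h1 : M%:R * (c d * M%:R ^+ d) <= M%:R * N + C * M%:R ^+ d.
  have := le_trans (_ : M%:R * (c d * M%:R ^+ d - N) <= _) hC.
  rewrite distrC => /(_ (ler_wpM2l (ltW M0') (ler_norm _))); lra.
have h2 : N <= M%:R ^+ d * (\sum_(n <- r) \prod_(k < d) (b n k - a n k) + (\sum_(n <- r) K n) / M%:R).
  apply: (le_trans hN); rewrite mulr_suml -big_split /= mulr_sumr; apply: ler_sum => n _.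
  have -> : \prod_(k < d) (M%:R * (b n k - a n k) + 1) =
     M%:R ^+ d * \prod_(k < d) (b n k - a n k + M%:R^-1).
    have -> : M%:R ^+ d = \prod_(k < d) M%:R :> R by rewrite prodr_const card_ord.
    rewrite -big_split /=; apply: eq_bigr => k _.
    by rewrite [RHS]mulrDr divff// gt_eqF.
  rewrite ler_pM2l//; apply: (KP n).2.
  by rewrite invr_ge0 (ltW M0')/= invf_le1.
rewrite -(ler_pM2r Md) mulrDl.
apply: (le_trans (_ : _ <= M%:R * (c d * M%:R ^+ d))); first by rewrite mulrA.
apply: (le_trans h1).
have := ler_wpM2l (ltW M0') h2.
set S := \sum_(n <- r) \prod_(_ < d) _; set T := \sum_(n <- r) K n => h3.
have -> : M%:R * S * M%:R ^+ d + (C + T) * M%:R ^+ d =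
  M%:R * (M%:R ^+ d * (S + T / M%:R)) + C * M%:R ^+ d by field; rewrite gt_eqF.
by rewrite lerD2r.
Qed.

End VolumeLower.

Section Volume.
Variables (R : realType) (I : finType).
Implicit Types (v : I -> nat -> R).

Lemma prod_bump_le n (s : nat -> R) (del : R) : (forall k, 0 <= s k) -> 0 < del ->
  exists2 e, 0 < e & \prod_(k < n) (s k + e) <= \prod_(k < n) s k + del.
Proof.
move=> s0 del0; have [K K0 KP] := prod_bump n s0.
have D0 : 0 < del + K + 1 by lra.
exists (del / (del + K + 1)); first by rewrite divr_gt0.
apply: (le_trans (KP _ _)).
  by rewrite divr_ge0 ?(ltW del0) ?(ltW D0)//= ler_pdivrMr//; lra.
rewrite lerD2l mulrCA -[leRHS]mulr1 ler_pM2l// ler_pdivrMr//; lra.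
Qed.

(** Each closed box of a cover is widened to an open one at a cost of [e / 2 ^ n.+1] in volume; by
    compactness finitely many of these suffice, and [leading_coef_le_cover] applies. *)
Lemma Vol_lower d (Q : set 'rV[R]_d) v (c : nat -> R) : hull_model Q v ->
  (forall m, (0 < m)%N -> int_count d (scale_family m v) = \sum_(k < d.+1) c k * m%:R ^+ k) ->
  ((c d)%:E <= Vol Q)%E.
Proof.
move=> Qv cE; apply: le_ereal_inf_tmp => _ [a [b [u [ab cov ->]]]].
apply/lee_addgt0Pr => e e0.
pose del n : R := e / (2 ^ n.+1)%:R.
have del0 n : 0 < del n by rewrite divr_gt0// ltr0n expn_gt0.
have side0 n k : 0 <= coords (b n) k - coords (a n) k.
  by rewrite subr_ge0 /coords; case: insub => // i; exact: ab.
have E_ n : exists e', 0 < e' /\ \prod_(k < d) (coords (b n) k - coords (a n) k + e') <=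
    \prod_(k < d) (coords (b n) k - coords (a n) k) + del n.
  by have [e' ? ?] := prod_bump_le d (side0 n) (del0 n); exists e'.
have [e_ eP] := choice E_.
have volE n : \prod_(k < d) (coords (b n) k - coords (a n) k) = box_vol (a n) (b n).
  by apply: eq_bigr => k _; rewrite !coord_ord.
pose a' n k := coords (a n) k - e_ n / 2.
pose b' n k := coords (b n) k + e_ n / 2.
have e_0 n : 0 < e_ n by case: (eP n).
have [r rD rcov] : exists2 r : seq nat, {in r, forall n, [set n | u n] n} &
    forall lam, is_weight 0 finset.setT v (fun=> 0) lam -> exists2 n, n \in r &
      forall k : 'I_d, a' n k < \sum_i lam i * v i k < b' n k.
  apply: weights_finite_cover => lam [l0 lS l1 _].
  pose q := to_row d (fun k => \sum_i lam i * v i k).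
  have /cov[n un qn] : Q q.
    by apply/Qv; exists lam; split=> // k kd; rewrite coord_to_row.
  exists n => // k; have := qn k; rewrite /a' /b' !mxE !coord_ord => /andP[h1 h2].
  by have := e_0 n; move=> he; apply/andP; split; lra.
have ab' n k : a' n k <= b' n k by have := side0 n k; have := e_0 n; rewrite /a' /b'; lra.
(* Without repetitions the finite sum is dominated by a partial sum of the series. *)
pose r' := undup r.
have rcov' lam : is_weight 0 finset.setT v (fun=> 0) lam -> exists2 n, n \in r' &
      forall k : 'I_d, a' n k < \sum_i lam i * v i k < b' n k.
  by move=> /rcov[n nr nP]; exists n => //; rewrite mem_undup.
have := leading_coef_le_cover cE ab' rcov'; rewrite -lee_fin => /le_trans; apply.
pose F n : R := if u n then box_vol (a n) (b n) else 0.
have F0 n : 0 <= F n by rewrite /F; case: ifP => // _; rewrite -volE prodr_ge0.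
pose N := (\max_(n <- r') n).+1.
have le_r (G : nat -> R) : (forall n, 0 <= G n) ->
    \sum_(n <- r') G n <= \sum_(0 <= n < N) G n.
  move=> G0; rewrite [leRHS](bigID (mem r'))/= -[leLHS]addr0 lerD ?sumr_ge0//.
  rewrite -[leRHS]big_filter (perm_big [seq n <- index_iota 0 N | n \in r'])//.
  apply: uniq_perm; rewrite ?undup_uniq ?filter_uniq ?iota_uniq// => n.
  rewrite mem_filter mem_index_iota /=; case: (boolP (n \in r')) => //= nr.
  by rewrite ltnS (bigD1_seq n) ?undup_uniq//= leq_maxl.
have step : \sum_(n <- r') \prod_(k < d) (b' n k - a' n k) <=
    \sum_(0 <= n < N) F n + \sum_(0 <= n < N) del n.
  apply: le_trans (_ : \sum_(n <- r') F n + \sum_(n <- r') del n <= _); last first.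
    by rewrite lerD// le_r// => n; exact: ltW.
  rewrite -big_split /= big_seq [leRHS]big_seq; apply: ler_sum => n nr.
  have un : u n by apply: rD; rewrite -mem_undup.
  rewrite /F un -volE; apply: le_trans (eP n).2.
  rewrite le_eqVlt; apply/orP; left; apply/eqP; apply: eq_bigr => k _.
  by rewrite /a' /b'; lra.
apply: (@le_trans _ _ ((\sum_(0 <= n < N) F n)%:E + (\sum_(0 <= n < N) del n)%:E)%E).
  by rewrite -EFinD lee_fin.
apply: leeD.
  rewrite -sumEFin; apply: le_trans (_ : (\sum_(0 <= n < N) (if u n then (box_vol (a n) (b n))%:E else 0) <= _)%E); last first.
    apply: nneseries_lim_ge => n _ _; case: ifP => // un.
    by have := F0 n; rewrite /F un lee_fin.
  by apply: lee_sum => n _; rewrite /F; case: ifP.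
apply: le_trans (epsilon_trick0 xpredT (ltW e0)).
rewrite -sumEFin; apply: nneseries_lim_ge => n _ _.
by rewrite lee_fin ltW// del0.
Qed.

Lemma Vol_model d (Q : set 'rV[R]_d) v (c : nat -> R) : hull_model Q v -> full_dim d v ->
  (forall m, (0 < m)%N -> int_count d (scale_family m v) = \sum_(k < d.+1) c k * m%:R ^+ k) ->
  Vol Q = (c d)%:E.
Proof.
move=> Qv fv cE; apply/eqP; rewrite eq_le (Vol_lower Qv cE) andbT.
exact: Vol_upper cE.
Qed.

End Volume.

(** * Vertices of lattice-face polytopes *)

Section HullModels.
Variable R : realType.

Lemma conv_hull_model (I : finType) d (Q : set 'rV[R]_d) (v : I -> nat -> R) x :
  hull_model Q v -> conv_hull Q x -> Q x.
Proof.
move=> Qv [n [p [w [pQ w0 w1 ->]]]].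
have c_ l := cid ((Qv (p l)).1 (pQ l)).
apply/Qv; exists (fun i => \sum_l w l * sval (c_ l) i); split.
- by move=> i; apply: sumr_ge0 => l _; rewrite mulr_ge0//; case: (svalP (c_ l)).
- by move=> i; rewrite finset.in_setT.
- rewrite exchange_big -[RHS]w1 /=; apply: eq_bigr => l _; rewrite -mulr_sumr.
  by case: (svalP (c_ l)) => _ _ -> _; rewrite mulr1.
move=> k kd; rewrite coord_sum; under eq_bigr do rewrite mulr_suml.
rewrite exchange_big /=; apply: eq_bigr => l _; rewrite coordZ.
have [_ _ _ <-//] := svalP (c_ l).
by rewrite mulr_sumr; apply: eq_bigr => i _; rewrite mulrA.
Qed.

Lemma aff_hull_model (I : finType) d (Q : set 'rV[R]_d) (v : I -> nat -> R) x :
  hull_model Q v -> aff_hull Q x ->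
  exists alpha : I -> R, \sum_i alpha i = 1 /\
    forall k, (k < d)%N -> \sum_i alpha i * v i k = coords x k.
Proof.
move=> Qv [n [p [w [pQ w1 ->]]]].
have c_ l := cid ((Qv (p l)).1 (pQ l)).
exists (fun i => \sum_l w l * sval (c_ l) i); split.
  rewrite exchange_big -[RHS]w1 /=; apply: eq_bigr => l _; rewrite -mulr_sumr.
  by case: (svalP (c_ l)) => _ _ -> _; rewrite mulr1.
move=> k kd; rewrite coord_sum; under eq_bigr do rewrite mulr_suml.
rewrite exchange_big /=; apply: eq_bigr => l _; rewrite coordZ.
have [_ _ _ <-//] := svalP (c_ l).
by rewrite mulr_sumr; apply: eq_bigr => i _; rewrite mulrA.
Qed.

Lemma conv_hull_sub d (S T : set 'rV[R]_d) : S `<=` T -> conv_hull S `<=` conv_hull T.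
Proof.
by move=> ST x [n [p [w [pS w0 w1 xE]]]]; exists n, p, w; split=> // i; apply: ST.
Qed.

Lemma in_conv_hull_fin (I : finType) d (S : set 'rV[R]_d) (u : I -> 'rV[R]_d) (lam : I -> R) x :
  (forall i, S (u i)) -> (forall i, 0 <= lam i) -> \sum_i lam i = 1 ->
  x = \sum_i lam i *: u i -> conv_hull S x.
Proof.
move=> uS l0 l1 ->; exists #|I|, (u \o enum_val), (lam \o enum_val).
have bij F : \sum_i F i = \sum_(j < #|I|) F (enum_val j) :> 'rV[R]_d.
  rewrite (reindex (@enum_val _ I))//; exists enum_rank => i _; [exact: enum_valK|exact: enum_rankK].
have bij' F : \sum_i F i = \sum_(j < #|I|) F (enum_val j) :> R.
  rewrite (reindex (@enum_val _ I))//; exists enum_rank => i _; [exact: enum_valK|exact: enum_rankK].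
by split=> [i|i||] /=; rewrite -?bij -?bij'.
Qed.

Lemma hull_model_conv_range (I : finType) d (v : I -> nat -> R) :
  hull_model (conv_hull (range (fun i => to_row d (v i)))) v.
Proof.
move=> x; split.
  have mem y : range (fun i => to_row d (v i)) y -> inhull d finset.setT v (coords y).
    case=> i _ <-; exists (fun j => (j == i)%:R); split=> //.
    - by move=> j; rewrite finset.in_setT.
    - by rewrite (bigD1 i)//= eqxx big1 ?addr0// => j /negPf ->.
    - move=> k kd; rewrite coord_to_row// (bigD1 i)//= eqxx mul1r big1 ?addr0// => j /negPf ->.
      exact: mul0r.
  pose Q := [set y : 'rV[R]_d | inhull d finset.setT v (coords y)].
  have Qv : hull_model Q v by [].
  by move=> /(conv_hull_sub mem)/(conv_hull_model Qv).
move=> [lam [l0 _ l1 lz]]; apply: (in_conv_hull_fin (u := fun i => to_row d (v i)) _ l0 l1).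
  by move=> i; exists i.
apply: coord_inj => k kd; rewrite -lz// coord_sum; apply: eq_bigr => i _.
by rewrite coordZ coord_to_row.
Qed.

Lemma full_dim_aff_hull (I : finType) d (Q : set 'rV[R]_d) (v : I -> nat -> R) :
  hull_model Q v -> aff_hull Q = setT -> full_dim d v.
Proof.
move=> Qv QT.
have aff (x : 'rV[R]_d) : exists alpha : I -> R, \sum_i alpha i = 1 /\
    forall k, (k < d)%N -> \sum_i alpha i * v i k = coords x k.
  by apply: (aff_hull_model Qv); rewrite QT.
have [al0 [al01 al0v]] := aff 0.
split.
  rewrite lt0n; apply/negP => /eqP/card0_eq I0; move/eqP: al01.
  by rewrite big_pred0 ?(eq_sym 0) ?oner_eq0// => i; have := I0 i; rewrite !inE.
move=> j jd; have [al [al1 alv]] := aff (to_row d (fun k => (k == j)%:R)).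
exists (fun i => al i - al0 i); split; first by rewrite sumrB al1 al01 subrr.
move=> k kd; under eq_bigr do rewrite mulrBl.
rewrite sumrB alv// al0v// coord_to_row// /coords.
by case: insub => [i|]; rewrite ?mxE subr0.
Qed.

Lemma full_dim_card (I : finType) d (v : I -> nat -> R) : full_dim d v -> (d <= #|I|)%N.
Proof.
move=> [_ etaP]; have E_ (j : 'I_d) := cid (etaP j (ltn_ord j)).
pose E := \matrix_(j < d, i < #|I|) sval (E_ j) (enum_val i).
pose V := \matrix_(i < #|I|, k < d) v (enum_val i) k.
have EV : E *m V = 1%:M.
  apply/matrixP => j k; rewrite !mxE; have [_ /(_ k (ltn_ord k))] := svalP (E_ j).
  rewrite eq_sym => <-; rewrite (reindex (@enum_val _ I))/=; last first.
    by exists enum_rank => i _; [exact: enum_valK|exact: enum_rankK].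
  by apply: eq_bigr => i _; rewrite !mxE.
have := mxrankM_maxr E V; rewrite EV mxrank1 => /leq_trans; apply.
exact: rank_leq_row.
Qed.

(** With a column of ones added, the points form a square matrix; full dimension makes its rows span
    everything, so they are also free. *)
Lemma full_dim_indep n (v : 'I_n.+1 -> nat -> R) : full_dim n v -> indep n finset.setT v.
Proof.
move=> [_ etaP] eta _ eta1 etav.
have E_ (j : 'I_n) := cid (etaP j (ltn_ord j)).
pose A := \matrix_(i < n.+1, j < n.+1) (if unlift ord0 j is Some j' then v i j' else 1).
have Afull : row_full A.
  rewrite -sub1mx; apply/row_subP => j; rewrite rowE mulmx1.
  case: (unliftP ord0 j) => [j'|] ->.
    apply/submxP; exists (\row_i sval (E_ j') i); apply/rowP => l; rewrite !mxE /=.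
    have [s1 sv] := svalP (E_ j'); case: (unliftP ord0 l) => [l'|] ->.
      rewrite (inj_eq lift_inj); under eq_bigr do rewrite !mxE liftK.
      by rewrite sv.
    under eq_bigr do rewrite !mxE unlift_none mulr1.
    by rewrite s1.
  (* The first point minus the combinations that reproduce its coordinates: total weight [1], all
     coordinates [0]. *)
  pose al (i : 'I_n.+1) := (i == ord0)%:R - \sum_(j < n) v ord0 j * sval (E_ j) i.
  apply/submxP; exists (\row_i al i); apply/rowP => l; rewrite !mxE /= eq_sym.
  have delta0 F : \sum_(i < n.+1) (i == ord0)%:R * F i = F ord0 :> R.
    by rewrite (bigD1 ord0)//= mul1r big1 ?addr0// => i /negPf ->; rewrite mul0r.
  have alE F : \sum_i al i * F i = F ord0 - \sum_(j < n) v ord0 j * \sum_i sval (E_ j) i * F i.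
    under eq_bigr do rewrite mulrBl mulr_suml.
    rewrite sumrB delta0 exchange_big /=; congr (_ - _); apply: eq_bigr => j' _.
    by rewrite mulr_sumr; apply: eq_bigr => i _; rewrite mulrA.
  case: (unliftP ord0 l) => [l'|] ->.
    under eq_bigr do rewrite !mxE liftK.
    rewrite alE (bigD1 l')//= (svalP (E_ l')).2// eqxx mulr1 big1 ?addr0 ?subrr//.
    move=> j' jl; rewrite (svalP (E_ j')).2// -[_ == _ :> nat]/(l' == j') eq_sym (negPf jl).
    exact: mulr0.
  under eq_bigr do rewrite !mxE unlift_none.
  rewrite (alE (fun=> 1)) big1 ?subr0// => j' _.
  by under eq_bigr do rewrite mulr1; rewrite (svalP (E_ j')).1 mulr0.
have Afree : row_free A by rewrite row_free_unit -row_full_unit.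
have etaA : (\row_i eta i) *m A = 0.
  apply/rowP => l; rewrite !mxE; case: (unliftP ord0 l) => [l'|] ->.
    by under eq_bigr do rewrite !mxE liftK; rewrite etav.
  by under eq_bigr do rewrite !mxE unlift_none mulr1.
have := row_free_inj Afree (etrans etaA (esym (mul0mx _ A))) => /rowP h i.
by have := h i; rewrite !mxE.
Qed.

End HullModels.

Section Vertices.
Variable R : realType.

(** Each of the averaged points differs from [v i], so its own weights put less than [1] on [i], and
    the average inherits this. One can then solve for [v i] in terms of the other points. *)
Lemma weight_of_nonvertex (I : finType) d (Q : set 'rV[R]_d) (v : I -> nat -> R) i :
  hull_model Q v -> conv_hull (Q `\ to_row d (v i)) (to_row d (v i)) ->
  exists2 beta, is_weight d finset.setT v (v i) beta & beta i < 1.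
Proof.
move=> Qv [n [p [w [pQ w0 w1 xE]]]].
have c_ l := cid ((Qv (p l)).1 (pQ l).1).
have c0 l j : 0 <= sval (c_ l) j by case: (svalP (c_ l)).
have c1 l : \sum_j sval (c_ l) j = 1 by case: (svalP (c_ l)).
have cp l k : (k < d)%N -> \sum_j sval (c_ l) j * v j k = coords (p l) k.
  by case: (svalP (c_ l)) => _ _ _; apply.
have cile l : sval (c_ l) i < 1.
  rewrite lt_neqAle; apply/andP; split; last first.
    by rewrite -(c1 l) (bigD1 i)//= lerDl sumr_ge0.
  apply/negP => /eqP ci; case: (pQ l) => _; apply.
  have others j : j != i -> sval (c_ l) j = 0.
    move=> ji; have := c1 l; rewrite (bigD1 i)//= ci (bigD1 j)//= => h.
    have : 0 <= \sum_(j' | (j' != i) && (j' != j)) sval (c_ l) j' by apply: sumr_ge0.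
    by have := c0 l j; lra.
  apply: coord_inj => k kd; rewrite coord_to_row// -cp// (bigD1 i)//= ci mul1r.
  by rewrite big1 ?addr0// => j /others ->; rewrite mul0r.
have [l wl] : exists l, 0 < w l.
  apply: contrapT => h; suff : \sum_l w l = 0 by rewrite w1 => /eqP; rewrite oner_eq0.
  apply: big1 => l _; apply/eqP; rewrite eq_le w0 andbT leNgt.
  by apply/negP => hl; apply: h; exists l.
exists (fun j => \sum_l w l * sval (c_ l) j); last first.
  rewrite -w1 (bigD1 l)//= [ltRHS](bigD1 l)//= ltr_leD//.
    by rewrite -[ltRHS]mulr1 ltr_pM2l.
  by apply: ler_sum => l' _; rewrite -[leRHS]mulr1 ler_wpM2l// ltW.
split.
- by move=> j; apply: sumr_ge0 => l' _; rewrite mulr_ge0.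
- by move=> j; rewrite finset.in_setT.
- rewrite exchange_big -[RHS]w1 /=; apply: eq_bigr => l' _; rewrite -mulr_sumr.
  by rewrite c1 mulr1.
move=> k kd; under eq_bigr do rewrite mulr_suml.
rewrite -[RHS](coord_to_row _ kd) xE coord_sum.
rewrite exchange_big /=; apply: eq_bigr => l' _; rewrite coordZ -cp//.
by rewrite mulr_sumr; apply: eq_bigr => j _; rewrite mulrA.
Qed.

Lemma is_weight_delta (I : finType) d (v : I -> nat -> R) i :
  is_weight d finset.setT v (v i) (fun j => (j == i)%:R).
Proof.
split=> //.
- by move=> j; rewrite finset.in_setT.
- by rewrite (bigD1 i)//= eqxx big1 ?addr0// => j /negPf ->.
- move=> k kd; rewrite (bigD1 i)//= eqxx mul1r big1 ?addr0// => j /negPf ->.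
  exact: mul0r.
Qed.

Lemma hull_model_mem (I : finType) d (Q : set 'rV[R]_d) (v : I -> nat -> R) i :
  hull_model Q v -> Q (to_row d (v i)).
Proof.
move=> Qv; apply/Qv.
have vi : inhull d finset.setT v (v i) by exists (fun j => (j == i)%:R); exact: (is_weight_delta d v i).
by apply: eq_inhull vi => k kd; rewrite coord_to_row.
Qed.

Lemma indep_is_vertex (I : finType) d (Q : set 'rV[R]_d) (v : I -> nat -> R) i :
  hull_model Q v -> indep d finset.setT v -> is_vertex Q (to_row d (v i)).
Proof.
move=> Qv ind; split; first exact: hull_model_mem i Qv.
move=> /(weight_of_nonvertex Qv)[beta betaw].
have := weight_unique ind betaw (is_weight_delta d v i) (finset.subsetT _) (finset.subsetT _).
by move=> /(_ i) ->; rewrite eqxx ltxx.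
Qed.

Lemma indep_inj (I : finType) d (v : I -> nat -> R) : indep d finset.setT v ->
  injective (fun i => to_row d (v i)).
Proof.
move=> ind i j vij; apply/eqP.
have wj : is_weight d finset.setT v (v i) (fun l => (l == j)%:R).
  have [h1 h2 h3 h4] := is_weight_delta d v j; split=> // k kd.
  by rewrite h4// -(coord_to_row (v j) kd) -vij coord_to_row.
have := weight_unique ind (is_weight_delta d v i) wj (finset.subsetT _) (finset.subsetT _).
by move=> /(_ i); rewrite eqxx; case: (i == j) => // /eqP; rewrite oner_eq0.
Qed.

(** Eliminates [v i] as the combination of the other [v j] with coefficients
    [beta j / (1 - beta i)]. *)
Lemma hull_model_lift n d (Q : set 'rV[R]_d) (v : 'I_n.+1 -> nat -> R) i beta :
  hull_model Q v -> is_weight d finset.setT v (v i) beta -> beta i < 1 ->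
  hull_model Q (v \o lift i).
Proof.
move=> Qv [b0 _ b1 bv] bi x; rewrite (Qv x).
have b1' : \sum_j beta (lift i j) = 1 - beta i.
  by rewrite -b1 (bigD1_ord i)//= addrC addrK.
have bN : 1 - beta i != 0 by rewrite subr_eq0 eq_sym lt_eqF.
split=> -[lam [l0 _ l1 lz]].
  have l1' : \sum_j lam (lift i j) = 1 - lam i by rewrite -l1 (bigD1_ord i)//= addrC addrK.
  exists (fun j => lam (lift i j) + lam i * beta (lift i j) / (1 - beta i)); split.
  - by move=> j; rewrite addr_ge0// divr_ge0 ?mulr_ge0// subr_ge0 ltW.
  - by move=> j; rewrite finset.in_setT.
  - by rewrite big_split /= -mulr_suml -mulr_sumr b1' l1'; field.
  move=> k kd; have bvk : \sum_j beta (lift i j) * v (lift i j) k = (1 - beta i) * v i k.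
    by have := bv k kd; rewrite (bigD1_ord i)//= => h; lra.
  rewrite -lz// (bigD1_ord i)//=; under eq_bigr do rewrite mulrDl.
  rewrite big_split /= addrC; congr (_ + _).
  transitivity (lam i / (1 - beta i) * \sum_j beta (lift i j) * v (lift i j) k).
    by rewrite mulr_sumr; apply: eq_bigr => j _; ring.
  by rewrite bvk; field.
exists (fun j => if unlift i j is Some j' then lam j' else 0); split.
- by move=> j; case: unlift.
- by move=> j; rewrite finset.in_setT.
- rewrite (bigD1_ord i)//= unlift_none add0r -l1.
  by apply: eq_bigr => j _; rewrite liftK.
move=> k kd; rewrite (bigD1_ord i)//= unlift_none mul0r add0r -lz//.
by apply: eq_bigr => j _; rewrite liftK.
Qed.

(** Take a generating family of minimal size: a point that is not a vertex, or that occurs twice,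
    could be discarded. *)
Lemma polytope_vertex_model d (P : set 'rV[R]_d) : polytope P ->
  exists n (v : 'I_n -> nat -> R), [/\ hull_model P v,
    forall i, is_vertex P (to_row d (v i)) & injective (fun i => to_row d (v i))].
Proof.
case=> s sP.
have exE : exists n, `[< exists v : 'I_n -> nat -> R, hull_model P v >].
  exists (size s); apply/asboolP; exists (fun i => coords (tnth (in_tuple s) i)).
  rewrite sP; have := @hull_model_conv_range R 'I_(size s) d (fun i => coords (tnth (in_tuple s) i)).
  congr (hull_model (conv_hull _) _); apply/seteqP; split=> x /=.
    by case=> i _ <-; rewrite (_ : to_row _ _ = tnth (in_tuple s) i) ?mem_tnth//;
      apply: coord_inj => k kd; rewrite coord_to_row.
  move=> /(nthP 0)[i si <-]; exists (Ordinal si) => //.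
  by apply: coord_inj => k kd; rewrite coord_to_row// (tnth_nth 0).
case: (ex_minnP exE) => n /asboolP[v Pv] nmin.
have irred i beta : is_weight d finset.setT v (v i) beta -> 1 <= beta i.
  case: n i v beta Pv nmin => [[]//|n] i v beta Pv nmin bw; rewrite leNgt; apply/negP => bi.
  have := nmin n; rewrite ltnn => h; apply: (Bool.diff_false_true); apply: h; apply/asboolP.
  by exists (v \o lift i); exact: hull_model_lift bi.
exists n, v; split=> // [i|i j vij].
  split; first exact: hull_model_mem i Pv.
  by move=> /(weight_of_nonvertex Pv)[beta /irred]; rewrite leNgt => /negP.
apply/eqP; have := irred i (fun l => (l == j)%:R); case: eqP => // ij.
rewrite leNgt ltr01; apply.
have [h1 h2 h3 h4] := is_weight_delta d v j; split=> // k kd.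
by rewrite h4// -(coord_to_row (v j) kd) -vij coord_to_row.
Qed.

End Vertices.

Section LatticeFace.
Variable R : realType.

Lemma lattice_face_1_aff (Q : set 'rV[R]_1) : lattice_face_1 Q -> aff_hull Q = setT.
Proof.
case=> a [b [ab ->]]; apply/seteqP; split=> // x _.
have ab' : a%:~R < b%:~R :> R by rewrite ltr_int.
pose t := (x ord0 ord0 - a%:~R) / (b%:~R - a%:~R).
exists 2%N, (fun i => if i == ord0 then const_mx a%:~R else const_mx b%:~R),
  (fun i => if i == ord0 then 1 - t else t); split.
- by move=> i; case: eqP => _; rewrite /= mxE lexx ?andbT ltW.
- by rewrite !big_ord_recl big_ord0 /=; ring.
rewrite !big_ord_recl big_ord0 /= addr0; apply/rowP => j; rewrite !mxE ord1 /t.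
by field; rewrite subr_eq0 gt_eqF.
Qed.

Lemma lattice_face_1_polytope (Q : set 'rV[R]_1) : lattice_face_1 Q -> polytope Q.
Proof.
case=> a [b [ab ->]]; have ab' : a%:~R < b%:~R :> R by rewrite ltr_int.
exists [:: const_mx a%:~R; const_mx b%:~R]; apply/seteqP; split=> x /=.
  move=> /andP[ax xb]; pose t := (x ord0 ord0 - a%:~R) / (b%:~R - a%:~R).
  have N : 0 < b%:~R - a%:~R :> R by rewrite subr_gt0.
  have t0 : 0 <= t by rewrite divr_ge0 ?subr_ge0// ltW.
  have t1 : t <= 1 by rewrite ler_pdivrMr// mul1r lerD2r.
  exists 2%N, (fun i => if i == ord0 then const_mx a%:~R else const_mx b%:~R),
    (fun i => if i == ord0 then 1 - t else t); split.
  - by move=> i; case: eqP => _; rewrite /= !inE eqxx ?orbT.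
  - by move=> i; case: eqP => _ //; rewrite subr_ge0.
  - by rewrite !big_ord_recl big_ord0 /=; ring.
  rewrite !big_ord_recl big_ord0 /= addr0; apply/rowP => j; rewrite !mxE ord1 /t.
  by field; rewrite gt_eqF.
move=> [n [p [w [pQ w0 w1 ->]]]]; rewrite summxE.
have pb l : a%:~R <= p l ord0 ord0 <= b%:~R.
  have := pQ l; rewrite /= !inE => /orP[]/eqP ->; rewrite mxE.
    by rewrite lexx ltW.
  by rewrite lexx andbT ltW.
under eq_bigr do rewrite mxE.
apply/andP; split.
  rewrite -[a%:~R]mul1r -[X in X * _ <= _]w1 mulr_suml; apply: ler_sum => l _.
  by rewrite ler_wpM2l//; case/andP: (pb l).
rewrite -[b%:~R]mul1r -[X in _ <= X * _]w1 mulr_suml; apply: ler_sum => l _.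
by rewrite ler_wpM2l//; case/andP: (pb l).
Qed.

Lemma lattice_face_1_vertex_int (Q : set 'rV[R]_1) x : lattice_face_1 Q ->
  is_vertex Q x -> x ord0 ord0 \is a Num.int.
Proof.
case=> a [b [ab ->]] [/= /andP[ax xb] nx].
have ab' : a%:~R < b%:~R :> R by rewrite ltr_int.
have [<-|xa] := eqVneq a%:~R (x ord0 ord0); first exact: intr_int.
have [->|xb'] := eqVneq (x ord0 ord0) b%:~R; first exact: intr_int.
case: nx; pose t := (x ord0 ord0 - a%:~R) / (b%:~R - a%:~R).
have N : 0 < b%:~R - a%:~R :> R by rewrite subr_gt0.
have t0 : 0 <= t by rewrite divr_ge0 ?subr_ge0// ltW.
have t1 : t <= 1 by rewrite ler_pdivrMr// mul1r lerD2r.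
exists 2%N, (fun i => if i == ord0 then const_mx a%:~R else const_mx b%:~R),
  (fun i => if i == ord0 then 1 - t else t); split.
- move=> i; split; first by case: eqP => _; rewrite /= mxE lexx ?andbT ltW.
  move=> ix; have := congr1 (fun y : 'rV[R]_1 => y ord0 ord0) ix.
  by case: eqP => _; rewrite mxE => /eqP; rewrite ?(negPf xa)// eq_sym (negPf xb').
- by move=> i; case: eqP => _ //; rewrite subr_ge0.
- by rewrite !big_ord_recl big_ord0 /=; ring.
rewrite !big_ord_recl big_ord0 /= addr0; apply/rowP => j; rewrite !mxE !ord1 /t.
by field; rewrite gt_eqF.
Qed.

Lemma lattice_face_polytope d (Q : set 'rV[R]_d) : lattice_face Q -> polytope Q.
Proof. by case: d Q => [|[|d]] Q //; [exact: lattice_face_1_polytope|case=> -[]]. Qed.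

Lemma lattice_face_aff d (Q : set 'rV[R]_d) : lattice_face Q -> aff_hull Q = setT.
Proof. by case: d Q => [|[|d]] Q //; [exact: lattice_face_1_aff|case=> -[]]. Qed.

Lemma exists_superset_card (I : finType) (U : {set I}) n : (#|U| <= n <= #|I|)%N ->
  exists W : {set I}, U \subset W /\ #|W| = n.
Proof.
elim: n => [|n IH] /andP[Un nI].
  by exists U; split=> //; apply/eqP; rewrite -leqn0.
move: Un; rewrite leq_eqVlt => /orP[/eqP Un|Un]; first by exists U.
have [|W [UW Wn]] := IH; first by rewrite -ltnS Un ltnW.
have /card_gt0P[x] : (0 < #|~: W|)%N by rewrite cardsCs finset.setCK Wn subn_gt0.
rewrite inE => xW; exists (x |: W); split; last by rewrite cardsU1 xW Wn.
by rewrite (fintype.subset_trans UW)// finset.subsetUr.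
Qed.

Lemma exists_enumeration (I : finType) (W : {set I}) n : #|W| = n ->
  exists2 w : 'I_n -> I, injective w & W = [set w j | j in finset.setT]%SET.
Proof.
move=> Wn; exists (fun j => enum_val (cast_ord (esym Wn) j)).
  by move=> i j /enum_val_inj/cast_ord_inj.
apply/setP => i; apply/idP/imsetP => [iW|[j _ ->]]; last exact: enum_valP.
exists (cast_ord Wn (enum_rank_in iW i)) => //.
by rewrite cast_ordK enum_rankK_in.
Qed.

Lemma sum_enumeration (I : finType) n (w : 'I_n -> I) (F : I -> R) : injective w ->
  (forall i, i \notin [set w j | j in finset.setT]%SET -> F i = 0) ->
  \sum_i F i = \sum_j F (w j).
Proof.
move=> winj FS; rewrite (sum_supp FS) big_imset /=; last by move=> i j _ _; exact: winj.
by apply: eq_bigl => j; rewrite finset.in_setT.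
Qed.

Lemma sub_aff_hull d (S T : set 'rV[R]_d) : S `<=` T -> aff_hull S `<=` aff_hull T.
Proof. by move=> ST x [n [p [w [pS w1 xE]]]]; exists n, p, w; split=> // i; apply: ST. Qed.

(* Condition (b) lifts the origin and the unit vectors to lattice points, which
   makes the coefficients of the affine function integral. *)
Lemma int_affine_of_section n (v : 'I_n.+1 -> nat -> R) : indep n finset.setT v ->
  proj_last (k := n.+1) @` (aff_hull (range (fun j => to_row n.+1 (v j))) `&` lattice (k := n.+1))
    = lattice (k := n) ->
  int_affine_on n finset.setT v.
Proof.
move=> ind sec.
have lift_ (f : nat -> R) : (forall k, f k \is a Num.int) ->
    exists alpha : 'I_n.+1 -> R, [/\ \sum_j alpha j = 1,
      forall k, (k < n)%N -> \sum_j alpha j * v j k = f k &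
      \sum_j alpha j * v j n \is a Num.int].
  move=> fint; have : lattice (to_row n f) by move=> i; rewrite mxE.
  rewrite -sec => -[x [xa xint] xf].
  have sub : range (fun j => to_row n.+1 (v j)) `<=` conv_hull (range (fun j => to_row n.+1 (v j))).
    by move=> _ [j _ <-]; exact: (hull_model_mem j (hull_model_conv_range v)).
  have [al [al1 alx]] := aff_hull_model (hull_model_conv_range v) (sub_aff_hull sub xa).
  exists al; split=> // [k kn|].
    rewrite alx ?(ltnW kn)//; last by rewrite ltnS ltnW.
    rewrite -(coord_to_row f kn) -xf [RHS]coordE mxE -coord_ord //.
  by rewrite alx// coordE; exact: xint.
have [al0 [al01 al0v al0n]] := lift_ (fun=> 0) (fun=> rpred0 _).
have [al alP] := choice (fun j : nat => lift_ (fun k => (k == j)%:R) (fun k => natr_int _ _)).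
pose c0 := \sum_j al0 j * v j n.
pose c l := \sum_j al l j * v j n - c0.
exists c0, c; split=> // [l|i _]; first by rewrite rpredB//; case: (alP l).
have [t tE] : exists t, t = 1 - \sum_(l < n) v i l by eexists.
(* [rho] compares two affine representations of [v i] in the first [n] coordinates: the point
   itself, and the combination of the lifts of the origin and the unit vectors with coefficients [t]
   and [v i l]. Independence makes them equal. *)
pose rho j := (j == i)%:R - t * al0 j - \sum_(l < n) v i l * al l j.
have rhoE F : \sum_j rho j * F j = F i - t * \sum_j al0 j * F j
    - \sum_(l < n) v i l * \sum_j al l j * F j.
  under eq_bigr do rewrite /rho !mulrBl mulr_suml.
  rewrite !sumrB exchange_big /=; congr (_ - _ - _).
  - by rewrite (bigD1 i)//= eqxx mul1r big1 ?addr0// => j /negPf ->; rewrite mul0r.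
  - by rewrite mulr_sumr; apply: eq_bigr => j _; ring.
  - by apply: eq_bigr => l _; rewrite mulr_sumr; apply: eq_bigr => j _; ring.
have rho0 j : rho j = 0.
  apply: ind => [l||k kn]; first by rewrite finset.in_setT.
    have := rhoE (fun=> 1).
    under eq_bigr do rewrite mulr1; under [X in _ * X]eq_bigr do rewrite mulr1.
    under [X in _ - X]eq_bigr => l _.
      under eq_bigr do rewrite mulr1.
      have [-> _ _] := alP l; rewrite mulr1; over.
    by rewrite al01 tE => ->; ring.
  rewrite rhoE al0v// mulr0 subr0 (bigD1 (Ordinal kn))//= [X in _ - (_ + X)]big1 => [|l lk].
    have [_ alk _] := alP k; by rewrite alk// eqxx mulr1 addr0 subrr.
  have [_ all_ _] := alP l; rewrite all_//; rewrite -(inj_eq val_inj) /= eq_sym in lk.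
  by rewrite (negPf lk) mulr0.
have := rhoE (fun j => v j n); rewrite big1 => [|j _]; last by rewrite rho0 mul0r.
have -> : \sum_(l < n) v i l * \sum_j al l j * v j n =
    \sum_(l < n) c l * v i l + (\sum_(l < n) v i l) * c0.
  by rewrite mulr_suml -big_split /=; apply: eq_bigr => l _; rewrite /c; ring.
rewrite -/c0 tE; lra.
Qed.

End LatticeFace.

(** * From lattice-face polytopes to general position, and the conclusion *)

Section Main.
Variable R : realType.

Lemma indep_enumeration (I : finType) n (w : 'I_n -> I) k (U : {set I}) (v : I -> nat -> R) :
  injective w -> U \subset [set w j | j in finset.setT]%SET ->
  indep k (w @^-1: U)%SET (v \o w) -> indep k U v.
Proof.
move=> winj /fintype.subsetP UW ind eta etaU eta1 etav.
have sumE F : \sum_i eta i * F i = \sum_j eta (w j) * F (w j).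
  apply: sum_enumeration => // i iW; rewrite etaU ?mul0r//.
  by apply: contra iW => /UW.
have etaw j : eta (w j) = 0.
  apply: (ind (eta \o w)) => [l||l lk] /=.
  - by rewrite inE => /etaU.
  - rewrite -[RHS]eta1 (sum_enumeration winj)// => i iW; apply: etaU.
    by apply: contra iW => /UW.
  - by rewrite -(sumE (v^~ l)) etav.
move=> i; have [/UW/imsetP[j _ ->]|/etaU//] := boolP (i \in U).
exact: etaw.
Qed.

Lemma int_affine_enumeration (I : finType) n (w : 'I_n -> I) k (U : {set I}) (v : I -> nat -> R) :
  U \subset [set w j | j in finset.setT]%SET ->
  int_affine_on k (w @^-1: U)%SET (v \o w) -> int_affine_on k U v.
Proof.
move=> /fintype.subsetP UW [c0 [c [c0int cint cU]]]; exists c0, c; split=> // u uU.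
have /imsetP[j _ uj] := UW u uU; rewrite uj; apply: cU.
by rewrite inE -uj.
Qed.

Lemma indep0 (I : finType) (U : {set I}) (v : I -> nat -> R) : (#|U| <= 1)%N -> indep 0 U v.
Proof.
move=> U1 eta etaU eta1 _ i; have [iU|/etaU//] := boolP (i \in U).
move: eta1; rewrite (bigD1 i)//= big1 ?addr0// => j ji; apply: etaU; apply/negP => jU.
have : (#|[set i; j]%SET| <= #|U|)%N.
  by apply: subset_leq_card; apply/fintype.subsetP => x; rewrite !inE => /orP[]/eqP ->.
by rewrite cards2 eq_sym ji leqNgt ltnS U1.
Qed.

Lemma lattice_general1 (I : finType) (v : I -> nat -> R) :
  (forall i, v i 0%N \is a Num.int) -> lattice_general 1 finset.setT v.
Proof.
move=> vint [|//] U _ _ U1; split; first exact: indep0.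
have [[u uU]|noU] := pselect (exists u, u \in U); last first.
  by exists 0, (fun=> 0); split=> // u uU; case: noU; exists u.
exists (v u 0%N), (fun=> 0); split=> // x xU; rewrite big_ord0 addr0.
by rewrite (card_le1_eqP U1 x u xU uU).
Qed.

(** Extend [U] to a set of [d] vertices. By (a) the projection of their hull is lattice-face, hence
    full-dimensional; its [d] points in dimension [d - 1] are then independent and are its vertices,
    so the induction hypothesis covers [k < d - 1]. For [k = d - 1], independence is that of the
    projected points and integrality comes from (b). *)
Lemma lattice_general_lattice_face d (I : finType) (Q : set 'rV[R]_d) (v : I -> nat -> R) :
  lattice_face Q -> hull_model Q v -> (forall i, is_vertex Q (to_row d (v i))) ->
  injective (fun i => to_row d (v i)) -> lattice_general d finset.setT v.
Proof.
elim: d I Q v => [//|[_ I Q v lfQ Qv vert inj|n IH I Q v lfQ Qv vert inj]].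
  apply: lattice_general1 => i.
  by have := lattice_face_1_vertex_int lfQ (vert i); rewrite mxE.
have fv := full_dim_aff_hull Qv (lattice_face_aff lfQ).
have [_ step] : @lattice_face_step R n.+2 (@lattice_face R n.+1) Q := lfQ.
move=> k U kn _ Uk.
have [|W [UW Wn]] := @exists_superset_card _ U n.+2.
  by rewrite (full_dim_card fv) (leq_trans Uk).
have [w winj WE] := exists_enumeration Wn; rewrite WE in UW.
have [||lf sec] := step (fun j => to_row n.+2 (v (w j))).
- by move=> i j /inj/winj.
- by move=> i; exact: vert.
have Q'v := hull_model_proj_last (hull_model_conv_range (v \o w) (d := n.+2)).
have fv' := full_dim_aff_hull Q'v (lattice_face_aff lf).
have ind' := full_dim_indep fv'.
have gen' : lattice_general n.+1 finset.setT (v \o w).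
  apply: (IH _ _ _ lf Q'v) => [i|]; first exact: indep_is_vertex.
  exact: indep_inj.
have [kn'|kn'] := ltnP k n.+1.
  have U'k : (#|(w @^-1: U)%SET| <= k.+1)%N.
    rewrite (leq_trans _ Uk)// -(card_imset _ winj) subset_leq_card//.
    by apply/fintype.subsetP => i /imsetP[j + ->]; rewrite inE.
  have [h1 h2] := gen' k _ kn' (finset.subsetT _) U'k.
  by split; [exact: indep_enumeration h1|exact: int_affine_enumeration h2].
have -> : k = n.+1 by apply/eqP; rewrite eqn_leq kn' -ltnS kn.
split.
  by apply: (indep_enumeration winj UW); apply: indep_sub ind'; exact: finset.subsetT.
apply: (int_affine_enumeration UW).
have [c0 [c [c0int cint cU]]] := int_affine_of_section ind' sec.
by exists c0, c; split=> // u _; apply: cU; rewrite finset.in_setT.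
Qed.

Lemma lattice_face_model d (P : set 'rV[R]_d) : lattice_face P ->
  exists n (v : 'I_n -> nat -> R),
    [/\ hull_model P v, lattice_general d finset.setT v & full_dim d v].
Proof.
move=> lf; have [n [v [Pv vert inj]]] := polytope_vertex_model (lattice_face_polytope lf).
exists n, v; split=> //; first exact: (lattice_general_lattice_face lf Pv).
exact: full_dim_aff_hull Pv (lattice_face_aff lf).
Qed.

Lemma full_dim_le (I : finType) d e (v : I -> nat -> R) : (e <= d)%N -> full_dim d v -> full_dim e v.
Proof.
move=> ed [I0 h]; split=> // j je; have [eta [e1 e2]] := h j (leq_trans je ed).
by exists eta; split=> // k ke; apply: e2; exact: leq_trans ed.
Qed.

Lemma full_dim_scale (I : finType) d m (v : I -> nat -> R) : (0 < m)%N ->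
  full_dim d v -> full_dim d (scale_family m v).
Proof.
move=> m0 [I0 h]; split=> // j jd; have [eta [e1 e2]] := h j jd.
have mN : m%:R != 0 :> R by rewrite pnatr_eq0 -lt0n.
exists (fun i => m%:R^-1 * eta i); split; first by rewrite -mulr_sumr e1 mulr0.
move=> k kd; rewrite -e2//; apply: eq_bigr => i _.
by rewrite /scale_family mulrACA mulVf// mul1r.
Qed.

Lemma scale_familyM (I : finType) m n (v : I -> nat -> R) :
  scale_family m (scale_family n v) = scale_family (m * n) v.
Proof. by apply/funext => i; apply/funext => k; rewrite /scale_family mulrA natrM. Qed.

End Main.

Theorem mainTheorem1 (R : realType) (d : nat) (P : set 'rV[R]_d) :
  lattice_face P ->
  forall m : nat, (0 < m)%N ->
    ((lattice_count P m)%:R)%:E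
      = (Vol ((fun x => m%:R *: x) @` P)
         + ((lattice_count (proj_last (R:=R) (k:=d) @` P) m)%:R)%:E)%E
    /\
    ((lattice_count P m)%:R)%:E
      = (\sum_(k < d.+1)
           Vol (proj_forget (R:=R) (k:=d) (d - k) @` P) * ((m%:R) ^+ k)%:E)%E.
Proof.
case: d P => [//|d] P lf m m0.
have [n [v [Pv gen fv]]] := lattice_face_model lf.
rewrite (lattice_count_model m0 Pv) (lattice_count_model m0 (hull_model_proj_last Pv)).
have countE e : (e <= d.+1)%N -> forall M, (0 < M)%N ->
    int_count e (scale_family M v) = \sum_(k < e.+1) ehrhart_coef v k * M%:R ^+ k.
  by move=> ed M M0; apply: int_count_scale => //; exact: lattice_general_le gen.
split.
  (* The counts of the dilated family have coefficients [ehrhart_coef v k * m ^ k]; the volume is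
     the leading one. *)
  have -> : Vol ((fun x => m%:R *: x) @` P) = (ehrhart_coef v d.+1 * m%:R ^+ d.+1)%:E.
    rewrite (Vol_model (hull_model_scale m0 Pv) (full_dim_scale m0 fv)
      (c := fun k => ehrhart_coef v k * m%:R ^+ k))// => M M0.
    rewrite scale_familyM countE ?muln_gt0 ?M0//; apply: eq_bigr => k _.
    by rewrite natrM exprMn; ring.
  rewrite -EFinD (countE d.+1 (leqnn _) m m0) (countE d (leqnSn _) m m0).
  by rewrite big_ord_recr /= addrC.
rewrite countE// -sumEFin; apply: eq_bigr => k _.
(* The dimension of the projected space equals [k] only propositionally. *)
have kd : (d.+1 - (d.+1 - k) = k)%N by rewrite subKn// -ltnS.
have -> : Vol (proj_forget (k := d.+1) (d.+1 - k) @` P) = (ehrhart_coef v k)%:E.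
  rewrite (Vol_model (hull_model_proj_forget Pv) (c := ehrhart_coef v)) ?kd//.
    by apply: full_dim_le fv; rewrite -ltnS.
  by apply: countE; rewrite -ltnS.
by rewrite EFinM.
Qed.
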